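(* Consider the longitudinal setting of the context and assume: (consistency) $Y=Y(\overline{A})$; (latent ignorability) for every $t$, $\{Z_t,A_t\}$ is conditionally independent of $Y(\underline{a}_t)$ given $(H_t,\overline{U}_t)$; (IV independence) for every $t$, $Z_t$ is conditionally independent of $\overline{U}_t$ given $H_t$. Let $s,r$ be integers with $0\le s\le T+1$, $r\ge0$ and $s+r\le T+1$. Suppose that for each $t=0,\dots,T$, $Z_t$ is an additive IV for $A_t$ and $\pi_t(Z_t,H_t)$ is a regular weighting function for $A_t$. Then $$\mathbb{E}[Y(\underline{a}_s)]=\mathbb{E}\left[\prod_{t=s}^{T-r}\frac{\left(\pi_t(Z_t,H_t)-\mathbb{E}[\pi_t(Z_t,H_t)\mid H_t]\right)I\{A_t=a_t\}}{\mathrm{Cov}\{I\{A_t=a_t\},\pi_t(Z_t,H_t)\mid H_t\}}\;\gamma^o_{T+1-r,\underline{a}_{T+1-r}}(H_{T+1-r})\right].$$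
   Context: Times $t=0,\dots,T$. At time $t$: $L_t$ observed confounders, $U_t$ unobserved confounders, $Z_t$ an instrument (multi-categorical or continuous), $A_t\in\mathcal{A}_t$ a discrete treatment (finite $\mathcal{A}_t$); $Y\in\mathbb{R}$ is an outcome observed at time $T+1$. Notation: $\overline{x}_t=[x_0,\dots,x_t]$, $\underline{x}_t=[x_t,\dots,x_T]$, $\overline{x}=\overline{x}_T$, $\underline{a}_{T+1}$ is empty; empty products equal 1. History: $H_t=[\overline{Z}_{t-1},\overline{A}_{t-1},\overline{L}_t]\in\mathcal{H}_t$ for $0\le t\le T$, and $H_{T+1}=O=[\overline{Z}_T,\overline{A}_T,\overline{L}_T,Y]$. $Y(\overline{a})$ is the potential outcome under treatment history $\overline{a}$, and $Y(\underline{a}_t)=Y(\overline{A}_{t-1},\underline{a}_t)$ is the potential outcome when treatments before $t$ are as observed and treatments from $t$ on are set to $\underline{a}_t$ (so $Y(\underline{a}_{T+1})=Y(\overline A)$). $\pi_t(Z_t,H_t)$ is a regular weighting function for $A_t$ if it is uniformly bounded and for each $a_t\in\mathcal{A}_t$ there is $\epsilon_0>0$ with $|\mathrm{Cov}\{I\{A_t=a_t\},\pi_t(Z_t,H_t)\mid H_t=h_t\}|\ge\epsilon_0$ for all $h_t\in\mathcal{H}_t$. $Z_t$ is an additive IV for $A_t$ if there exist functions $b_{t,a_t}(\overline{U}_t,H_t)$ and $c_{t,a_t}(Z_t,H_t)$ such that $\Pr(A_t=a_t\mid Z_t,\overline{U}_t,H_t)=b_{t,a_t}(\overline{U}_t,H_t)+c_{t,a_t}(Z_t,H_t)$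 for all $a_t\in\mathcal{A}_t$. For the given $\pi_t$, set $\gamma^o_{T+1,\underline{a}_{T+1}}(H_{T+1}):=Y$ and recursively for $t=T,\dots,0$ $$\gamma^o_{t,\underline{a}_t}(H_t):=\frac{\mathrm{Cov}\{I\{A_t=a_t\}\gamma^o_{t+1,\underline{a}_{t+1}}(H_{t+1}),\pi_t(Z_t,H_t)\mid H_t\}}{\mathrm{Cov}\{I\{A_t=a_t\},\pi_t(Z_t,H_t)\mid H_t\}}.$$ *)

(* Defs.v *)
From HB Require Import structures.
From mathcomp Require Import all_boot all_order all_algebra.
From mathcomp Require Import all_classical all_reals all_analysis.

Set Implicit Arguments.
Unset Strict Implicit.
Unset Printing Implicit Defensive.

Import Order.TTheory GRing.Theory Num.Theory.
Import numFieldNormedType.Exports.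

Local Open Scope classical_set_scope.
Local Open Scope ring_scope.

HB.mixin Record isDiscreteMeasurable (d : measure_display) T
    & Measurable d T := {
  measurable_discrete : forall B : set T, measurable B
}.

#[short(type="finDiscreteType")]
HB.structure Definition FinDiscrete d :=
  {T of Measurable d T & Finite T & isDiscreteMeasurable d T}.

(* [g] is a version of [s |-> E[f | X = s]]; [g \o X] is then a version of
   E[f | X], the conditional expectation given the sigma-algebra of [X]. *)
Definition is_cexp d d' (Omega : measurableType d) (S : measurableType d')
    (R : realType) (P : probability Omega R) (X : Omega -> S)
    (f : Omega -> R) (g : S -> R) : Prop :=
  [/\ measurable_fun [set: S] g,
      P.-integrable [set: Omega] (fun w => (g (X w))%:E) &
      forall B : set S, measurable B ->
        (\int[P]_(w in X @^-1` B) (g (X w))%:E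
         = \int[P]_(w in X @^-1` B) (f w)%:E)%E].

(* A version fixed once and for all. Versions of the conditional expectation of
   an integrable [f] given a measurable [X] exist and agree almost everywhere
   for the law of [X]; the value [0] is for other arguments only. *)
Definition cexp d d' (Omega : measurableType d) (S : measurableType d')
    (R : realType) (P : probability Omega R) (X : Omega -> S)
    (f : Omega -> R) : S -> R :=
  xget (fun=> 0) [set g | is_cexp P X f g].

Definition cprob d d' (Omega : measurableType d) (S : measurableType d')
    (R : realType) (P : probability Omega R) (X : Omega -> S)
    (E : set Omega) : S -> R :=
  cexp P X \1_E.

Definition ccov d d' (Omega : measurableType d) (S : measurableType d')
    (R : realType) (P : probability Omega R) (X : Omega -> S)
    (f g : Omega -> R) : S -> R :=
  cexp P X (fun w => (f w - cexp P X f (X w)) * (g w - cexp P X g (X w))).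

Definition cindep d d1 d2 d' (Omega : measurableType d)
    (S1 : measurableType d1) (S2 : measurableType d2) (S : measurableType d')
    (R : realType) (P : probability Omega R)
    (X1 : Omega -> S1) (X2 : Omega -> S2) (X : Omega -> S) : Prop :=
  forall (B1 : set S1) (B2 : set S2), measurable B1 -> measurable B2 ->
    {ae P, forall w,
      cprob P X (X1 @^-1` B1 `&` X2 @^-1` B2) (X w) =
      cprob P X (X1 @^-1` B1) (X w) * cprob P X (X2 @^-1` B2) (X w)}.

(* The times are 0, ..., T. The families are indexed by [nat] for convenience;
   nothing below depends on their members at times beyond [T]. *)
Record longData d (Omega : measurableType d) (R : realType) (T : nat) :=
  LongData {
  dispL : nat -> measure_display;
  dispU : nat -> measure_display;
  dispZ : nat -> measure_display;
  dispA : nat -> measure_display;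
  typL : forall t, measurableType (dispL t);
  typU : forall t, measurableType (dispU t);
  typZ : forall t, measurableType (dispZ t);
  typA : forall t, finDiscreteType (dispA t);
  obsL : forall t, {mfun Omega >-> typL t};
  latU : forall t, {mfun Omega >-> typU t};
  insZ : forall t, {mfun Omega >-> typZ t};
  trtA : forall t, {mfun Omega >-> typA t};
  outY : {mfun Omega >-> R};
  potY : {dffun forall t : 'I_T.+1, typA t} -> {mfun Omega >-> R}
}.
Arguments potY {d Omega R T} l _.

Section LongitudinalData.
Context d (Omega : measurableType d) (R : realType) (T : nat)
  (D : longData Omega R T).

(* The history H_t = [Z_0..Z_(t-1), A_0..A_(t-1), L_0..L_t], nested as
   ((H_(t-1), (Z_(t-1), A_(t-1))), L_t), with the product sigma-algebra. *)
Fixpoint dispH (t : nat) : measure_display :=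
  if t is n.+1 then
    measure_prod_display
      (measure_prod_display
         (dispH n, measure_prod_display (dispZ D n, dispA D n)),
       dispL D n.+1)
  else dispL D 0.

Fixpoint typH (t : nat) : measurableType (dispH t) :=
  match t return measurableType (dispH t) with
  | 0 => typL D 0
  | n.+1 => (typH n * (typZ D n * typA D n) * typL D n.+1)%type
  end.

Fixpoint hist (t : nat) : Omega -> typH t :=
  match t return Omega -> typH t with
  | 0 => obsL D 0
  | n.+1 => fun w => ((hist n w, (insZ D n w, trtA D n w)), obsL D n.+1 w)
  end.

(* [U_0..U_t] *)
Fixpoint dispUbar (t : nat) : measure_display :=
  if t is n.+1 then measure_prod_display (dispUbar n, dispU D n.+1)
  else dispU D 0.

Fixpoint typUbar (t : nat) : measurableType (dispUbar t) :=
  match t return measurableType (dispUbar t) with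
  | 0 => typU D 0
  | n.+1 => (typUbar n * typU D n.+1)%type
  end.

Fixpoint latUbar (t : nat) : Omega -> typUbar t :=
  match t return Omega -> typUbar t with
  | 0 => latU D 0
  | n.+1 => fun w => (latUbar n w, latU D n.+1 w)
  end.

(* Y(A_0..A_(t-1), a_t..a_T) *)
Definition potYfrom (a : forall t, typA D t) (t : nat) (w : Omega) : R :=
  potY D [ffun i : 'I_T.+1 => if (i < t)%N then trtA D i w else a i] w.

Definition trtI (t : nat) (a : typA D t) : Omega -> R :=
  \1_[set w | trtA D t w = a].

(* pi_t(Z_t, H_t) *)
Definition weightRV (t : nat) (p : typZ D t * typH t -> R) (w : Omega) : R :=
  p (insZ D t w, hist t w).

Variable P : probability Omega R.

Definition consistency : Prop :=
  {ae P, forall w, outY D w = potY D [ffun i : 'I_T.+1 => trtA D i w] w}.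

Definition latent_ignorability : Prop :=
  forall (a : forall t, typA D t) (t : nat), (t <= T)%N ->
    cindep P (fun w => (insZ D t w, trtA D t w)) (potYfrom a t)
      (fun w => (hist t w, latUbar t w)).

Definition IV_independence : Prop :=
  forall t : nat, (t <= T)%N -> cindep P (insZ D t) (latUbar t) (hist t).

Definition additive_IV (t : nat) : Prop :=
  forall a : typA D t,
    exists (b : typUbar t * typH t -> R) (c : typZ D t * typH t -> R),
    [/\ measurable_fun setT b, measurable_fun setT c &
        {ae P, forall w,
          cprob P (fun w' => (insZ D t w', (latUbar t w', hist t w')))
            [set w' | trtA D t w' = a] (insZ D t w, (latUbar t w, hist t w))
          = b (latUbar t w, hist t w) + c (insZ D t w, hist t w)}].

(* Conditional covariances given H_t = h being defined up to null sets of the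
   law of H_t, the lower bound is required for almost every h. *)
Definition regular_weight (t : nat) (p : typZ D t * typH t -> R) : Prop :=
  [/\ measurable_fun setT p,
      exists M : R, forall x, `|p x| <= M &
      forall a : typA D t, exists2 eps : R, 0 < eps &
        {ae P, forall w,
          eps <= `|ccov P (hist t) (trtI a) (weightRV p) (hist t w)|}].

(* [gammaT1B pi a k] is the random variable gamma_(T+1-k)(H_(T+1-k)). *)
Fixpoint gammaT1B (pi : forall t, typZ D t * typH t -> R)
    (a : forall t, typA D t) (k : nat) : Omega -> R :=
  if k is j.+1 then
    let t := (T - j)%N in
    fun w =>
      ccov P (hist t) (fun w' => trtI (a t) w' * gammaT1B pi a j w')
        (weightRV (pi t)) (hist t w)
      / ccov P (hist t) (trtI (a t)) (weightRV (pi t)) (hist t w)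
  else outY D.

(* gamma_t(H_t), for t <= T+1 *)
Definition gamma (pi : forall t, typZ D t * typH t -> R)
    (a : forall t, typA D t) (t : nat) : Omega -> R :=
  gammaT1B pi a (T.+1 - t).

End LongitudinalData.

(* Main.v *)
Require Import Defs.
From mathcomp Require Import all_boot all_order all_algebra.
From mathcomp Require Import all_classical all_reals all_analysis.
From mathcomp Require Import measurable_realfun ring.

Set Implicit Arguments.
Unset Strict Implicit.
Unset Printing Implicit Defensive.

Import Order.TTheory GRing.Theory Num.Theory.
Import numFieldNormedType.Exports.

Local Open Scope classical_set_scope.
Local Open Scope ring_scope.

(* Write p = pi_t(Z_t, H_t), I = I{A_t = a_t}, e = E[p | H_t], and let W_t be
   the factor (p - e) I / Cov(I, p | H_t).
   The IV independence gives E[p - e | U, H] = 0, so with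
   P(A_t = a_t | Z, U, H) = b(U, H) + c(Z, H) the b-part drops out of
   E[(p - e) I | U, H], and the c-part does not depend on U: hence
   E[(p - e) I | U, H] = Cov(I, p | H). As b and c need not be integrable
   separately, this is done on the events |b| <= n, where c is bounded too.
   On I = 1 one has Y(a_(t+1)..) = Y(a_t..), and by latent ignorability
   E[W_t Y(a_(t+1)..) | H_t] = E[Y(a_t..) | H_t]. Multiplying by a function
   of H_t and iterating peels off the product one factor at a time; the same
   identity shows by descending induction that gamma_t and Y(a_t..) have the
   same conditional expectation given H_t. *)

Local Notation rint P f := (P.-integrable [set: _] (fun w => (f w)%:E)).
Local Notation Ex P f := (Rintegral P [set: _] f).

(** * Expectations of integrable functions *)

Section Expectation.
Context d (Omega : measurableType d) (R : realType) (P : probability Omega R).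
Implicit Types f g h : Omega -> R.

(** The bound is almost sure because versions of conditional expectations inherit bounds only
    outside null sets. *)
Definition ae_bounded f := exists C : R, {ae P, forall w, `|f w| <= C}.

Lemma ae_bounded_le f C : (forall w, `|f w| <= C) -> ae_bounded f.
Proof. by move=> fC; exists C; exact: aeW. Qed.

Lemma ae_boundedB f g : ae_bounded f -> ae_bounded g -> ae_bounded (f \- g).
Proof.
move=> [C fC] [D gD]; exists (C + D).
by apply: filterS2 fC gD => w fC gD; rewrite (le_trans (ler_normB _ _)) ?lerD.
Qed.

Lemma ae_boundedM f g : ae_bounded f -> ae_bounded g -> ae_bounded (f \* g).
Proof.
move=> [C fC] [D gD]; exists (C * D).
by apply: filterS2 fC gD => w fC gD; rewrite normrM ler_pM.
Qed.

Lemma ae_bounded_indic d' (S : measurableType d') (X : Omega -> S) (B : set S) :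
  ae_bounded (fun w => \1_B (X w)).
Proof.
by apply: (@ae_bounded_le _ 1) => w; rewrite indicE; case: (_ \in _);
  rewrite ?normr0 ?normr1.
Qed.

Lemma integrable_measurable f : rint P f -> measurable_fun [set: Omega] f.
Proof. by move=> /measurable_int /measurable_EFinP. Qed.

Lemma integrable_subr f g : rint P f -> rint P g -> rint P (fun w => f w - g w).
Proof. by move=> fi gi; exact: (integrableB measurableT fi gi). Qed.

Lemma integrable_addr f g : rint P f -> rint P g -> rint P (fun w => f w + g w).
Proof. by move=> fi gi; exact: (integrableD measurableT fi gi). Qed.

Lemma integrable_aeboundedM f h : rint P f -> measurable_fun [set: Omega] h ->
  ae_bounded h -> rint P (fun w => f w * h w).
Proof.
move=> fi mh [C hC]; have mf := integrable_measurable fi.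
apply/integrableP; split.
  by apply/measurable_EFinP; exact: measurable_funM.
have ifC : rint P (fun w => `|C| * `|f w|).
  exact: (@integrableZl _ _ _ P _ measurableT _ _ (integrable_abse fi)).
case/integrableP: ifC => mfC; apply: le_lt_trans.
apply: ae_ge0_le_integral => //.
- apply/measurable_EFinP; apply: measurableT_comp => //.
  exact: measurable_funM.
- by apply/measurableT_comp => //; exact: mfC.
- apply: filterS hC => w hC _; rewrite lee_fin !normrM mulrC !normr_id.
  by rewrite ler_pM// (le_trans hC)// ler_norm.
Qed.

Lemma integrable_ae_bounded f :
  measurable_fun [set: Omega] f -> ae_bounded f -> rint P f.
Proof.
move=> mf bf; have i1 : rint P (fun=> 1 : R).
  exact: finite_measure_integrable_cst.
have := integrable_aeboundedM i1 mf bf.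
by under eq_fun do rewrite mul1r.
Qed.

Lemma eq_Ex f g : f =1 g -> Ex P f = Ex P g.
Proof. by move=> fg; apply: eq_Rintegral => w _. Qed.

Lemma ae_eq_Ex f g : measurable_fun [set: Omega] f ->
  measurable_fun [set: Omega] g -> {ae P, forall w, f w = g w} ->
  Ex P f = Ex P g.
Proof.
move=> mf mg fg; rewrite /Rintegral; congr fine.
apply: ae_eq_integral => //; [exact/measurable_EFinP|exact/measurable_EFinP|].
by apply: filterS fg => w -> _.
Qed.

Lemma expectation_Ex f : rint P f -> ('E_P[f] = (Ex P f)%:E)%E.
Proof. by move=> fi; rewrite unlock fineK//; exact: integrable_fin_num. Qed.

Lemma integrable_ae_eq f g : measurable_fun [set: Omega] g ->
  {ae P, forall w, f w = g w} -> rint P f -> rint P g.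
Proof.
move=> mg fg fi; have mf := integrable_measurable fi.
case/integrableP: fi => _ fi; apply/integrableP; split.
  exact/measurable_EFinP.
apply: le_lt_trans fi; apply: ae_ge0_le_integral => //.
- by apply/measurable_EFinP; exact: measurableT_comp.
- by apply/measurable_EFinP; exact: measurableT_comp.
- by apply: filterS fg => w ->.
Qed.

Lemma dominated_Ex (f_ : (Omega -> R)^nat) f g :
  (forall n, measurable_fun [set: Omega] (f_ n)) ->
  measurable_fun [set: Omega] f ->
  (forall w, f_ ^~ w @ \oo --> f w) -> rint P g ->
  (forall n w, `|f_ n w| <= `|g w|) ->
  (fun n => Ex P (f_ n)) @ \oo --> Ex P f.
Proof.
move=> mf_ mf cf ig fg.
have [] := @dominated_convergence _ _ _ P setT measurableT
  (fun n w => (f_ n w)%:E) (fun w => (f w)%:E) (fun w => `|g w|%:E).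
- by move=> n; exact/measurable_EFinP.
- exact/measurable_EFinP.
- by apply: aeW => w _; apply/fine_cvgP; split; [exact: nearW|exact: cf].
- exact: (integrable_abse ig).
- by apply: aeW => w n _; rewrite lee_fin.
move=> fi _ cE.
by move: cE; rewrite -[X in _ --> X -> _]fineK ?integrable_fin_num// =>
  /fine_cvg.
Qed.

End Expectation.

(** * Conditional expectations *)

Section CondExp.
Context d d' (Omega : measurableType d) (S : measurableType d') (R : realType)
  (P : probability Omega R) (X : Omega -> S).
Hypothesis mX : measurable_fun [set: Omega] X.
Implicit Types (f : Omega -> R) (g k : S -> R).

Lemma measurable_preimage (B : set S) : measurable B -> measurable (X @^-1` B).
Proof. by move=> mB; rewrite -[X in measurable X]setTI; exact: mX. Qed.

Lemma measurable_indicX (B : set S) : measurable B ->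
  measurable_fun [set: Omega] (fun w => \1_B (X w) : R).
Proof.
by move=> mB; apply: measurableT_comp => //; exact: measurable_indic.
Qed.

Lemma integrable_indicX f (B : set S) : rint P f -> measurable B ->
  rint P (fun w => f w * \1_B (X w)).
Proof.
move=> fi mB; apply: integrable_aeboundedM => //;
  first exact: measurable_indicX.
exact: ae_bounded_indic.
Qed.

(** Moves the set of integration into an indicator, so that conditional expectations can be handled
    by real-valued arithmetic under [Ex]. *)
Lemma integral_preimageE f (B : set S) : rint P f -> measurable B ->
  (\int[P]_(w in X @^-1` B) (f w)%:E
   = (Ex P (fun w => f w * \1_B (X w)))%:E)%E.
Proof.
move=> fi mB; rewrite /Rintegral fineK; last first.
  by apply: integrable_fin_num => //; exact: integrable_indicX.
rewrite [LHS]integral_mkcond; apply: eq_integral => w _.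
rewrite patchE indicE.
have -> : (w \in X @^-1` B) = (X w \in B) by apply/idP/idP; rewrite !inE.
by case: ifPn => _ /=; rewrite ?mulr1 ?mulr0.
Qed.

Lemma is_cexpP f g : rint P f ->
  is_cexp P X f g <->
  [/\ measurable_fun [set: S] g, rint P (g \o X) &
      forall B, measurable B -> Ex P (fun w => g (X w) * \1_B (X w)) =
                                Ex P (fun w => f w * \1_B (X w))].
Proof.
move=> fi; split=> -[mg gi gf]; split=> // B mB; have := gf B mB.
  by rewrite !integral_preimageE// => -[].
by rewrite !integral_preimageE// => ->.
Qed.

Lemma is_cexp_exists f : rint P f -> exists g, is_cexp P X f g.
Proof.
move=> fi.
pose nu : {charge set Omega -> \bar R} := induced_charge fi.
unshelve epose (nuX := (pushforward nu X : {charge set S -> \bar R})).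
  exact: mX.
pose X' : {mfun Omega >-> S} := mfun_Sub (mem_set mX).
pose mu := distribution P X'.
have numu : nuX `<< mu.
  apply/null_content_dominatesP => A mA muA0.
  rewrite /nuX /= /pushforward /nu /= /induced_charge.
  apply: null_set_integral => //.
    exact: measurable_preimage.
  by apply: measurable_funTS; exact: measurable_int fi.
pose g s := fine (Radon_Nikodym nuX mu s).
have gE s : (g s)%:E = Radon_Nikodym nuX mu s.
  by rewrite fineK//; exact: Radon_Nikodym_fin_num.
have gi : mu.-integrable [set: S] (fun s => (g s)%:E).
  by under eq_fun do rewrite gE; exact: Radon_Nikodym_integrable.
have mg : measurable_fun [set: S] g.
  by apply/measurable_EFinP; exact: measurable_int gi.
have gXi : rint P (g \o X).
  apply/integrableP; split.
    by apply/measurable_EFinP; exact: measurableT_comp.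
  case/integrableP: gi => _; rewrite ge0_integral_distribution//.
  by apply: measurableT_comp => //; exact/measurable_EFinP.
exists g; split => // B mB.
transitivity (nuX B); last by [].
rewrite (Radon_Nikodym_integral numu mB).
under [RHS]eq_integral do rewrite -gE.
rewrite integral_pushforward//; first exact/measurable_EFinP.
apply: integrableS gXi => //; exact: measurable_preimage.
Qed.

Lemma cexpP f : rint P f -> is_cexp P X f (cexp P X f).
Proof.
move=> /is_cexp_exists [g fg].
exact: (@xgetPex _ _ [set g | is_cexp P X f g] (ex_intro _ g fg)).
Qed.

(** Testing on [B = {k < g}] gives a nonnegative function [(g - k) 1_B] with nonpositive
    expectation; it vanishes almost surely, which is possible only off [B]. *)
Lemma le_ae_of_Ex g k : measurable_fun [set: S] g ->
  measurable_fun [set: S] k ->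
  rint P (g \o X) -> rint P (k \o X) ->
  (forall B, measurable B -> Ex P (fun w => g (X w) * \1_B (X w)) <=
                             Ex P (fun w => k (X w) * \1_B (X w))) ->
  {ae P, forall w, g (X w) <= k (X w)}.
Proof.
move=> mg mk gi ki gk.
pose B := [set s | k s < g s].
have mB : measurable B.
  rewrite [B](_ : _ = [set: S] `&` (fun s => k s < g s) @^-1` [set true]).
    exact: measurable_fun_ltr.
  by rewrite setTI.
pose h w := g (X w) * \1_B (X w) - k (X w) * \1_B (X w).
have gBi := integrable_indicX gi mB.
have kBi := integrable_indicX ki mB.
have hi : rint P h by exact: integrable_subr.
have mh := integrable_measurable hi.
have h0 w : 0 <= h w.
  rewrite /h -mulrBl indicE; have [|_] := boolP (X w \in B); rewrite ?mulr0//.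
  by rewrite inE /B /= mulr1 subr_ge0 => /ltW.
have : (\int[P]_w `|(h w)%:E| = 0)%E.
  under eq_integral do rewrite gee0_abs ?lee_fin ?h0//.
  apply/eqP; rewrite eq_le integral_ge0 ?andbT//;
    last by move=> w _; rewrite lee_fin.
  rewrite -[leLHS]fineK ?integrable_fin_num// lee_fin -/(Rintegral P setT h).
  by rewrite RintegralB// subr_le0 gk.
move/(ae_eq_integral_abs P measurableT ((measurable_EFinP _ _).2 mh)).1.
apply: filterS => w /(_ I) [] /=; rewrite /h -mulrBl indicE.
have [|] := boolP (X w \in B);
  last by rewrite notin_setE /B /= => /negP; rewrite -leNgt.
rewrite inE /B /= mulr1 => kg /eqP; rewrite subr_eq0 => /eqP gkE.
by move: kg; rewrite gkE ltxx.
Qed.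

Lemma eq_ae_of_Ex g k : measurable_fun [set: S] g ->
  measurable_fun [set: S] k ->
  rint P (g \o X) -> rint P (k \o X) ->
  (forall B, measurable B -> Ex P (fun w => g (X w) * \1_B (X w)) =
                             Ex P (fun w => k (X w) * \1_B (X w))) ->
  {ae P, forall w, g (X w) = k (X w)}.
Proof.
move=> mg mk gi ki gk.
have h1 : {ae P, forall w, g (X w) <= k (X w)}.
  by apply: le_ae_of_Ex => // B mB; rewrite gk.
have h2 : {ae P, forall w, k (X w) <= g (X w)}.
  by apply: le_ae_of_Ex => // B mB; rewrite gk.
by apply: filterS2 h1 h2 => w h1 h2; apply/eqP; rewrite eq_le h1.
Qed.

Lemma is_cexp_ae_unique f g k : rint P f -> is_cexp P X f g ->
  is_cexp P X f k -> {ae P, forall w, g (X w) = k (X w)}.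
Proof.
move=> fi /(is_cexpP _ fi) [mg gi gf] /(is_cexpP _ fi) [mk ki kf].
by apply: eq_ae_of_Ex => // B mB; rewrite gf// kf.
Qed.

(** If [C] bounds [f], then [g] is compared with the constants [C] and [- C] through their
    expectations on every test set. *)
Lemma is_cexp_ae_bounded f g : rint P f -> ae_bounded P f ->
  is_cexp P X f g -> ae_bounded P (g \o X).
Proof.
move=> fi [C fC] /(is_cexpP _ fi) [mg gi gf].
have iC (c : R) : rint P (cst c \o X).
  exact: finite_measure_integrable_cst.
have le_ae f1 f2 : rint P f1 -> rint P f2 ->
    {ae P, forall w, f1 w <= f2 w} -> forall B, measurable B ->
    Ex P (fun w => f1 w * \1_B (X w)) <= Ex P (fun w => f2 w * \1_B (X w)).
  move=> i1 i2 h12 B mB.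
  rewrite -subr_ge0 -RintegralB//; try exact: integrable_indicX.
  have i12 := integrable_indicX (integrable_subr i2 i1) mB.
  (* The difference is nonnegative only almost surely; replacing it by its absolute value makes the
     integrand nonnegative at every point. *)
  rewrite (@ae_eq_Ex _ _ _ P _ (fun w => `|(f2 w - f1 w) * \1_B (X w)|)).
  - by apply: Rintegral_ge0.
  - under eq_fun do rewrite -mulrBl.
    exact: integrable_measurable i12.
  - by apply: measurableT_comp => //; exact: integrable_measurable i12.
  - apply: filterS h12 => w h12; rewrite -mulrBl ger0_norm//.
    by rewrite mulr_ge0 ?subr_ge0// indicE.
exists C.
have h1 : {ae P, forall w, g (X w) <= cst C (X w)}.
  apply: le_ae_of_Ex => // B mB; rewrite gf//;
    apply: (le_ae _ _ fi (iC C)) => //.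
  by apply: filterS fC => w; exact/le_trans/ler_norm.
have h2 : {ae P, forall w, cst (- C) (X w) <= g (X w)}.
  apply: le_ae_of_Ex => // B mB; rewrite gf//;
    apply: (le_ae _ _ (iC _) fi) => //.
  by apply: filterS fC => w; rewrite ler_norml => /andP[].
by apply: filterS2 h1 h2 => w h1 h2; rewrite ler_norml h1 andbT.
Qed.

End CondExp.

Lemma indic_preimage (T U : Type) (R : pzRingType) (X : T -> U) (B : set U)
    (w : T) :
  \1_(X @^-1` B) w = \1_B (X w) :> R.
Proof. by rewrite !indicE; congr (_%:R); apply/idP/idP; rewrite !inE. Qed.

Lemma indic_setX (T U : Type) (R : pzRingType) (A : set T) (B : set U) x y :
  \1_(A `*` B) (x, y) = \1_A x * \1_B y :> R.
Proof. by rewrite !indicE in_setX; case: (x \in A); rewrite ?mul1r ?mul0r. Qed.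

(** * Orthogonality: from indicators to integrable test functions *)

Section TestFunctions.
Context d d' (Omega : measurableType d) (S : measurableType d') (R : realType)
  (P : probability Omega R) (X : Omega -> S) (h : Omega -> R).
Hypothesis mX : measurable_fun [set: Omega] X.
Hypothesis hi : rint P h.

Import HBSimple HBNNSimple.

(** A simple function is a finite combination of indicators of its level sets, and each of these
    contributes zero. *)
Lemma Ex_mul_sfun0 (k : {nnsfun S >-> R}) :
  (forall B, measurable B -> Ex P (fun w => h w * \1_B (X w)) = 0) ->
  Ex P (fun w => h w * k (X w)) = 0.
Proof.
move=> h0.
pose u y w := h w * (y * \1_(k @^-1` [set y]) (X w)).
have mk y : measurable (k @^-1` [set y]) by exact: measurable_funPTI.
have ui y : rint P (u y).
  have := integrable_indicX mX hi (mk y).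
  move=> /(@integrableZl _ _ _ P _ measurableT y);
    apply: eq_integrable => // w _.
  by rewrite /u mulrCA EFinM.
have u0 y : Ex P (u y) = 0.
  rewrite (@eq_Ex _ _ _ _ _ (fun w => y * (h w * \1_(k @^-1` [set y]) (X w)))).
    by rewrite RintegralZl//; [rewrite h0 ?mulr0|exact: integrable_indicX].
  by move=> w; rewrite /u mulrCA.
pose s : seq R := finmap.enum_fset (fset_set (range k)).
have us (r : seq R) : rint P (fun w => \sum_(y <- r) u y w) /\
    Ex P (fun w => \sum_(y <- r) u y w) = 0.
  elim: r => [|y r [ri r0]].
    under eq_fun do rewrite big_nil.
    split; first exact: integrable0.
    rewrite (@eq_Ex _ _ _ _ _ (cst 0)) ?Rintegral_cst ?mul0r//.
    by move=> w; rewrite big_nil.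
  under eq_fun do rewrite big_cons.
  split; first exact: integrable_addr.
  rewrite (@eq_Ex _ _ _ _ _ (fun w => u y w + \sum_(y <- r) u y w)).
    by rewrite (RintegralD measurableT (ui y) ri) (u0 y) r0 addr0.
  by move=> w; rewrite big_cons.
rewrite -[RHS](us s).2; apply: eq_Ex => w.
rewrite fimfunE fsbig_finite//=.
by rewrite mulr_sumr.
Qed.

(** Simple functions increase to [k]; as they stay below [k], the integrable product [h * k]
    dominates and the zero expectations pass to the limit. *)
Lemma Ex_mul_ge0_0 (k : S -> R) :
  (forall B, measurable B -> Ex P (fun w => h w * \1_B (X w)) = 0) ->
  measurable_fun [set: S] k -> (forall s, 0 <= k s) ->
  rint P (fun w => h w * k (X w)) ->
  Ex P (fun w => h w * k (X w)) = 0.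
Proof.
move=> h0 mk k0 hki.
have mkE : measurable_fun [set: S] (EFin \o k) by exact/measurable_EFinP.
pose k_ := nnsfun_approx measurableT mkE.
have k_le n s : k_ n s <= k s.
  by rewrite -lee_fin /k_ nnsfun_approxE; apply: le_approx => // x _;
    rewrite lee_fin.
have k_cvg s : k_ ^~ s @ \oo --> k s.
  have := @cvg_nnsfun_approx _ _ _ _ measurableT _ mkE (fun x _ => k0 x) s I.
  by move/fine_cvg.
have mh := integrable_measurable hi.
have : (fun n => Ex P (fun w => h w * k_ n (X w))) @ \oo -->
    Ex P (fun w => h w * k (X w)).
  apply: (dominated_Ex _ _ _ hki).
  - by move=> n; apply: measurable_funM => //; exact: measurableT_comp.
  - exact: integrable_measurable hki.
  - by move=> w; apply: cvgM; [exact: cvg_cst|exact: k_cvg].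
  - by move=> n w; rewrite !normrM ler_wpM2l// !ger0_norm.
under eq_fun do rewrite Ex_mul_sfun0//.
by move=> /cvg_lim <-//; rewrite lim_cst.
Qed.

(** Positive and negative parts of [k] are both dominated by [|k|], so each product with [h] remains
    integrable and the nonnegative case applies twice. *)
Lemma Ex_mul0 (k : S -> R) :
  (forall B, measurable B -> Ex P (fun w => h w * \1_B (X w)) = 0) ->
  measurable_fun [set: S] k ->
  rint P (fun w => h w * k (X w)) ->
  Ex P (fun w => h w * k (X w)) = 0.
Proof.
move=> h0 mk hki; have mh := integrable_measurable hi.
have mkp : measurable_fun [set: S] k^\+ by exact: measurable_funrpos.
have mkn : measurable_fun [set: S] k^\- by exact: measurable_funrneg.
have part (l : S -> R) : measurable_fun [set: S] l ->
    (forall s, 0 <= l s <= `|k s|) -> rint P (fun w => h w * l (X w)).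
  move=> ml lk; apply: le_integrable hki => //.
    by apply/measurable_EFinP; apply: measurable_funM => //;
      exact: measurableT_comp.
  move=> w _; rewrite lee_fin !normrM ler_wpM2l//.
  by have /andP[l0 ?] := lk (X w); rewrite (ger0_norm l0).
have kp s : 0 <= k^\+ s <= `|k s|.
  by rewrite funrpos_ge0/= /funrpos ge_max normr_ge0 ler_norm.
have kn s : 0 <= k^\- s <= `|k s|.
  by rewrite funrneg_ge0/= /funrneg ge_max normr_ge0 -normrN ler_norm.
have kpi := part _ mkp kp; have kni := part _ mkn kn.
rewrite (@eq_Ex _ _ _ _ _ (fun w => h w * k^\+ (X w) - h w * k^\- (X w))).
  rewrite RintegralB// !Ex_mul_ge0_0 ?subr0//.
by move=> w; rewrite -mulrBr -[in LHS](funrposBneg k).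
Qed.

End TestFunctions.

(** The residual [f - g(X)] is orthogonal to every indicator of [X], hence to [k(X)]. This exchanges
    a variable for its conditional expectation in everything that follows. *)
Lemma Ex_cexp d d' (Omega : measurableType d) (S : measurableType d')
    (R : realType) (P : probability Omega R) (X : Omega -> S)
    (f : Omega -> R) (g k : S -> R) :
  measurable_fun [set: Omega] X -> rint P f -> is_cexp P X f g ->
  measurable_fun [set: S] k ->
  rint P (fun w => f w * k (X w)) -> rint P (fun w => g (X w) * k (X w)) ->
  Ex P (fun w => f w * k (X w)) = Ex P (fun w => g (X w) * k (X w)).
Proof.
move=> mX fi /(is_cexpP mX _ fi)[mg gi gf] mk fki gki.
apply/eqP; rewrite -subr_eq0 -RintegralB//; apply/eqP.
rewrite (@eq_Ex _ _ _ _ _ (fun w => (f w - g (X w)) * k (X w))); last first.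
  by move=> w; rewrite mulrBl.
apply: Ex_mul0 => //; first exact: integrable_subr.
  move=> B mB.
  rewrite (@eq_Ex _ _ _ _ _ (fun w => f w * \1_B (X w) - g (X w) * \1_B (X w))).
    rewrite RintegralB ?gf ?subrr//; first exact: integrable_indicX.
    exact: (integrable_indicX mX gi mB).
  by move=> w; rewrite mulrBl.
by under eq_fun do rewrite mulrBl; exact: integrable_subr.
Qed.

(** A pi-lambda argument: rectangles are stable under intersection and generate the product
    sigma-algebra, while the sets on which the expectation vanishes form a Dynkin system. *)
Lemma Ex_indic_rectangles d d1 d2 (Omega : measurableType d)
    (S1 : measurableType d1) (S2 : measurableType d2) (R : realType)
    (P : probability Omega R) (X1 : Omega -> S1) (X2 : Omega -> S2)
    (h : Omega -> R) :
  measurable_fun [set: Omega] X1 -> measurable_fun [set: Omega] X2 ->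
  rint P h ->
  (forall B1 B2, measurable B1 -> measurable B2 ->
    Ex P (fun w => h w * (\1_B1 (X1 w) * \1_B2 (X2 w))) = 0) ->
  forall C, measurable C -> Ex P (fun w => h w * \1_C (X1 w, X2 w)) = 0.
Proof.
move=> mX1 mX2 hi h0.
have mX : measurable_fun [set: Omega] (fun w => (X1 w, X2 w)).
  exact: measurable_fun_pair.
have hT : Ex P h = 0.
  rewrite -[RHS](h0 setT setT)//; apply: eq_Ex => w.
  by rewrite !indicT !mulr1.
move=> C mC.
have EC := integral_preimageE mX hi.
have : <<s [set A `*` B | A in @measurable _ S1 & B in @measurable _ S2] >> C.
  by rewrite -measurable_prod_measurableType.
pose Q := [set C : set (S1 * S2) | Ex P (fun w => h w * \1_C (X1 w, X2 w)) = 0].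
move=> sC; apply: (@dynkin_induction _ _ _ Q _ _ _ _ _ _ C sC) => /=.
- exact: measurable_prod_measurableType.
- move=> _ _ [A1 mA1 [A2 mA2 <-]] [B1 mB1 [B2 mB2 <-]].
  exists (A1 `&` B1); first exact: measurableI.
  by exists (A2 `&` B2); [exact: measurableI|rewrite setXI].
- by rewrite /Q /= -[RHS]hT; apply: eq_Ex => w; rewrite indicT mulr1.
- move=> _ [A mA [B mB <-]]; rewrite /Q /= -[RHS](h0 A B)//.
  by apply: eq_Ex => w; rewrite indic_setX.
- move=> A mA A0; rewrite /Q /=.
  rewrite (@eq_Ex _ _ _ _ _ (fun w => h w - h w * \1_A (X1 w, X2 w))).
    by rewrite RintegralB//; [rewrite hT A0 subrr|exact: integrable_indicX].
  move=> w; rewrite !indicE in_setC.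
  by case: (_ \in _); rewrite ?mulr0 ?mulr1 ?subr0 ?subrr.
- move=> F mF tF F0; rewrite /Q /=.
  have mFU : measurable (\bigcup_k F k) by exact: bigcupT_measurable.
  (* For disjoint unions, countable additivity of the integral of [h] over preimages gives a series
     of zeros. *)
  suff : (Ex P (fun w => h w * \1_(\bigcup_k F k) (X1 w, X2 w)))%:E = 0%E.
    by move=> [].
  rewrite -EC// preimage_bigcup integral_bigcup//.
  + by rewrite eseries0// => i _ _; rewrite EC// F0.
  + apply/trivIsetP => i j _ _ ij; rewrite -preimage_setI.
    by move/trivIsetP : tF => /(_ _ _ I I ij) ->; rewrite preimage_set0.
  + by move=> k; exact: measurable_preimage.
  + apply: integrableS hi => //; rewrite -preimage_bigcup.
    exact: measurable_preimage.
Qed.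

(** * Conditional independence and conditional covariance *)

Lemma integrable_indic_preimage d d' (Omega : measurableType d)
    (S : measurableType d') (R : realType) (P : probability Omega R)
    (Y : Omega -> S) (B : set S) :
  measurable_fun [set: Omega] Y -> measurable B ->
  rint P (\1_(Y @^-1` B) : Omega -> R).
Proof.
move=> mY mB; under eq_fun do rewrite indic_preimage.
apply: integrable_ae_bounded; first exact: measurable_indicX.
exact: ae_bounded_indic.
Qed.

Lemma ae_bounded_indic_set d (Omega : measurableType d) (R : realType)
    (P : probability Omega R) (A : set Omega) :
  ae_bounded P (\1_A : Omega -> R).
Proof. exact: (@ae_bounded_indic _ _ _ _ _ _ id). Qed.

Section ConditionalIndependence.
Context d d1 d2 d' (Omega : measurableType d) (S1 : measurableType d1)
  (S2 : measurableType d2) (S : measurableType d') (R : realType)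
  (P : probability Omega R) (X1 : Omega -> S1) (X2 : Omega -> S2)
  (X : Omega -> S).
Hypotheses (mX1 : measurable_fun [set: Omega] X1)
  (mX2 : measurable_fun [set: Omega] X2) (mX : measurable_fun [set: Omega] X).
Hypothesis iX : cindep P X1 X2 X.

(* E[1_B2(X2) | X1, X] = P(X2 in B2 | X) *)
Lemma cindep_indic (B2 : set S2) (C : set (S1 * S)) :
  measurable B2 -> measurable C ->
  Ex P (fun w => (\1_(X2 @^-1` B2) w - cprob P X (X2 @^-1` B2) (X w))
                 * \1_C (X1 w, X w)) = 0.
Proof.
move=> mB2; set q := cprob P X _.
have i2 := integrable_indic_preimage P mX2 mB2.
have q2 : is_cexp P X \1_(X2 @^-1` B2) q by exact: cexpP.
have [mq qi _] := q2.
have qb : ae_bounded P (q \o X).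
  exact: is_cexp_ae_bounded (ae_bounded_indic_set P _) q2.
apply: Ex_indic_rectangles => //; first exact: integrable_subr.
move=> B1 B mB1 mB.
have i1 := integrable_indic_preimage P mX1 mB1.
have q1 := cexpP mX i1; have [mq1 q1i _] := q1.
have m12 : measurable (X1 @^-1` B1 `&` X2 @^-1` B2).
  by apply: measurableI; exact: measurable_preimage.
have i12 : rint P (\1_(X1 @^-1` B1 `&` X2 @^-1` B2) : Omega -> R).
  exact: (integrable_indic_preimage P (@measurable_id _ Omega setT) m12).
have q12 := cexpP mX i12.
have mqB : measurable_fun [set: S] (fun s => q s * \1_B s).
  by apply: measurable_funM => //; exact: measurable_indic.
have qBb : ae_bounded P (fun w => q (X w) * \1_B (X w)).
  by apply: ae_boundedM => //; exact: ae_bounded_indic.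
have mqBX : measurable_fun [set: Omega] (fun w => q (X w) * \1_B (X w)).
  exact: measurableT_comp mqB mX.
have mB1B : measurable_fun [set: Omega]
    (fun w => \1_B1 (X1 w) * \1_B (X w) : R).
  by apply: measurable_funM; exact: measurable_indicX.
have bB1B : ae_bounded P (fun w => \1_B1 (X1 w) * \1_B (X w) : R).
  by apply: ae_boundedM; exact: ae_bounded_indic.
rewrite (@eq_Ex _ _ _ _ _ (fun w =>
    \1_(X2 @^-1` B2) w * (\1_B1 (X1 w) * \1_B (X w)) -
    q (X w) * (\1_B1 (X1 w) * \1_B (X w)))); last first.
  by move=> w; rewrite mulrBl.
rewrite RintegralB//; try exact: integrable_aeboundedM.
apply/eqP; rewrite subr_eq0; apply/eqP.
transitivity (Ex P (fun w =>
    \1_(X1 @^-1` B1 `&` X2 @^-1` B2) w * \1_B (X w))).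
  by apply: eq_Ex => w; rewrite indicI/= -(indic_preimage R X1); ring.
have [mq12 q12i <-//] := (is_cexpP mX _ i12).1 q12.
(* Conditional independence factors the joint conditional probability; [Ex_cexp] then turns the
   factor belonging to [X1] back into its indicator. *)
transitivity (Ex P (fun w =>
  cexp P X \1_(X1 @^-1` B1) (X w) * (q (X w) * \1_B (X w)))).
  apply: ae_eq_Ex.
  - by apply: measurable_funM;
      [exact: measurableT_comp|exact: measurable_indicX].
  - by apply: measurable_funM => //; exact: measurableT_comp.
  - by apply: filterS (iX mB1 mB2) => w; rewrite /cprob => ->; rewrite -mulrA.
rewrite -(Ex_cexp mX i1 q1 mqB).
- by apply: eq_Ex => w; rewrite -(indic_preimage R X1); ring.
- exact: integrable_aeboundedM.
- exact: (integrable_aeboundedM q1i).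
Qed.

(** Given [X], the variable [X2] carries no further information on [X1], so conditioning on
    [(X2, X)] amounts to conditioning on [X]. On a rectangle, [1_B2(X2)] is split into
    [P(X2 in B2 | X)] and a remainder. *)
Lemma cindep_cexp (phi : S1 * S -> R) :
  measurable_fun [set: S1 * S] phi -> rint P (fun w => phi (X1 w, X w)) ->
  is_cexp P (fun w => (X2 w, X w)) (fun w => phi (X1 w, X w))
    (cexp P X (fun w => phi (X1 w, X w)) \o snd).
Proof.
move=> mphi fi; set f := (fun w => phi (X1 w, X w)); set g := cexp P X f.
have fg : is_cexp P X f g by exact: cexpP.
have [mg gi _] := fg.
have m2X : measurable_fun [set: Omega] (fun w => (X2 w, X w)).
  exact: measurable_fun_pair.
have m1X : measurable_fun [set: Omega] (fun w => (X1 w, X w)).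
  exact: measurable_fun_pair.
apply/(is_cexpP m2X _ fi); split => //.
  by apply: measurableT_comp => //; exact: measurable_snd.
move=> C mC; apply/eqP; rewrite -subr_eq0 -RintegralB//; last 2 first.
- exact: (integrable_indicX m2X gi mC).
- exact: (integrable_indicX m2X fi mC).
apply/eqP.
rewrite (@eq_Ex _ _ _ _ _ (fun w => (g (X w) - f w) * \1_C (X2 w, X w)));
    last first.
  by move=> w; rewrite mulrBl.
have gfi : rint P (fun w => g (X w) - f w) by exact: integrable_subr.
apply: Ex_indic_rectangles => // B2 B mB2 mB.
set q := cprob P X (X2 @^-1` B2).
have i2 := integrable_indic_preimage P mX2 mB2.
have q2 : is_cexp P X \1_(X2 @^-1` B2) q by exact: cexpP.
have [mq qi _] := q2.
have qb : ae_bounded P (q \o X).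
  exact: is_cexp_ae_bounded (ae_bounded_indic_set P _) q2.
have mqX : measurable_fun [set: Omega] (q \o X) by exact: measurableT_comp.
have mB2' : measurable_fun [set: Omega] (\1_(X2 @^-1` B2) : Omega -> R).
  exact: integrable_measurable i2.
have bB2 := ae_bounded_indic_set P (X2 @^-1` B2).
have fBi : rint P (fun w => f w * \1_B (X w)) by exact: integrable_indicX.
have gBi : rint P (fun w => g (X w) * \1_B (X w)).
  exact: (integrable_indicX mX gi).
(* The remainder [D] is orthogonal to functions of [(X1, X)] by [cindep_indic], and to functions of
   [X] by definition of [q]; so it contributes nothing against [f] or [g]. *)
pose D w := \1_(X2 @^-1` B2) w - q (X w).
have Di : rint P D by exact: integrable_subr.
have mD := integrable_measurable Di.
have bD : ae_bounded P D by exact: ae_boundedB.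
have fBD : Ex P (fun w => f w * \1_B (X w) * D w) = 0.
  rewrite (@eq_Ex _ _ _ _ _ (fun w =>
      D w * (fun s => phi s * \1_B s.2) (X1 w, X w))); last first.
    by move=> w; rewrite mulrC.
  apply: (Ex_mul0 m1X Di (k := fun s => phi s * \1_B s.2)) => /=.
  - by move=> E mE; exact: cindep_indic.
  - apply: measurable_funM => //; apply: measurableT_comp;
      last exact: measurable_snd.
    exact: measurable_indic.
  - under eq_fun do rewrite mulrC.
    exact: (integrable_aeboundedM fBi).
have gBD : Ex P (fun w => g (X w) * \1_B (X w) * D w) = 0.
  rewrite (@eq_Ex _ _ _ _ _ (fun w =>
      D w * (fun s => g s * \1_B s) (X w))); last first.
    by move=> w; rewrite mulrC.
  apply: (Ex_mul0 mX Di (k := fun s => g s * \1_B s)) => /=.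
  - move=> E mE.
    have [_ _ qE] := (is_cexpP mX _ i2).1 q2.
    rewrite (@eq_Ex _ _ _ _ _ (fun w =>
      \1_(X2 @^-1` B2) w * \1_E (X w) - q (X w) * \1_E (X w))); last first.
      by move=> w; rewrite mulrBl.
    rewrite RintegralB ?qE ?subrr//; first exact: integrable_indicX.
    exact: (integrable_indicX mX qi).
  - by apply: measurable_funM => //; exact: measurable_indic.
  - under eq_fun do rewrite mulrC.
    exact: (integrable_aeboundedM gBi).
have mqB : measurable_fun [set: S] (fun s => q s * \1_B s).
  by apply: measurable_funM => //; exact: measurable_indic.
have bqB : ae_bounded P (fun w => q (X w) * \1_B (X w)).
  by apply: ae_boundedM => //; exact: ae_bounded_indic.
have mqBX : measurable_fun [set: Omega] (fun w => q (X w) * \1_B (X w)).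
  exact: measurableT_comp mqB mX.
have fgq : Ex P (fun w => f w * (q (X w) * \1_B (X w))) =
           Ex P (fun w => g (X w) * (q (X w) * \1_B (X w))).
  apply: (Ex_cexp mX fi fg mqB); first exact: integrable_aeboundedM.
  exact: (integrable_aeboundedM gi).
have fBDi : rint P (fun w => f w * \1_B (X w) * D w).
  exact: integrable_aeboundedM.
have gBDi : rint P (fun w => g (X w) * \1_B (X w) * D w).
  exact: integrable_aeboundedM.
have fqi : rint P (fun w => f w * (q (X w) * \1_B (X w))).
  exact: integrable_aeboundedM.
have gqi : rint P (fun w => g (X w) * (q (X w) * \1_B (X w))).
  exact: (integrable_aeboundedM gi).
(* With [1_B2(X2) = D + q(X)], the [D] terms vanish and the [q] terms cancel because [g] is the
   conditional expectation of [f] given [X]. *)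
transitivity ((Ex P (fun w => g (X w) * \1_B (X w) * D w)
               + Ex P (fun w => g (X w) * (q (X w) * \1_B (X w))))
            - (Ex P (fun w => f w * \1_B (X w) * D w)
               + Ex P (fun w => f w * (q (X w) * \1_B (X w))))); last first.
  by rewrite gBD fBD fgq subrr.
rewrite -!RintegralD// -RintegralB//; [|exact: integrable_addr..].
by apply: eq_Ex => w; rewrite /D -(indic_preimage R X2); ring.
Qed.

End ConditionalIndependence.

Section ConditionalCovariance.
Context d d' (Omega : measurableType d) (S : measurableType d') (R : realType)
  (P : probability Omega R) (X : Omega -> S).
Hypothesis mX : measurable_fun [set: Omega] X.

Lemma Ex_centered0 (p : Omega -> R) (k : S -> R) :
  measurable_fun [set: Omega] p -> ae_bounded P p ->
  measurable_fun [set: S] k -> rint P (k \o X) ->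
  Ex P (fun w => k (X w) * (p w - cexp P X p (X w))) = 0.
Proof.
move=> mp bp mk ki.
have pi := integrable_ae_bounded mp bp; have pe := cexpP mX pi.
have [me ei _] := pe.
have be := is_cexp_ae_bounded mX pi bp pe.
have meX : measurable_fun [set: Omega] (cexp P X p \o X)
  by exact: measurableT_comp.
have kpi : rint P (fun w => k (X w) * p w) by exact: (integrable_aeboundedM ki).
have kei : rint P (fun w => k (X w) * cexp P X p (X w)).
  exact: (integrable_aeboundedM ki).
rewrite (@eq_Ex _ _ _ _ _ (fun w =>
    k (X w) * p w - k (X w) * cexp P X p (X w))); last first.
  by move=> w; rewrite mulrBr.
rewrite RintegralB//; apply/eqP; rewrite subr_eq0; apply/eqP.
transitivity (Ex P (fun w => p w * k (X w))); first by apply: eq_Ex => w;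
  rewrite mulrC.
rewrite (Ex_cexp mX pi pe mk).
- by apply: eq_Ex => w; rewrite mulrC.
- by under eq_fun do rewrite mulrC.
- by under eq_fun do rewrite mulrC.
Qed.

Lemma ae_bounded_centered (p : Omega -> R) :
  measurable_fun [set: Omega] p -> ae_bounded P p ->
  ae_bounded P (fun w => p w - cexp P X p (X w)).
Proof.
move=> mp bp; have pi := integrable_ae_bounded mp bp.
by apply: ae_boundedB => //; exact: is_cexp_ae_bounded (cexpP mX pi).
Qed.

Lemma measurable_centered (p : Omega -> R) :
  measurable_fun [set: Omega] p -> ae_bounded P p ->
  measurable_fun [set: Omega] (fun w => p w - cexp P X p (X w)).
Proof.
move=> mp bp; have pi := integrable_ae_bounded mp bp.
have [me _ _] := cexpP mX pi.
by apply: measurable_funB => //; exact: measurableT_comp.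
Qed.

(** Centering one factor is enough: [E[f | X]] times the centered [p] has conditional mean zero.
    This links the covariances in the denominators to the numerators of the weights. *)
Lemma is_cexp_ccov (f p : Omega -> R) :
  rint P f -> measurable_fun [set: Omega] p -> ae_bounded P p ->
  is_cexp P X (fun w => f w * (p w - cexp P X p (X w))) (ccov P X f p).
Proof.
move=> fi mp bp; set e := cexp P X p.
have mc : measurable_fun [set: Omega] (fun w => p w - e (X w)).
  exact: measurable_centered.
have bc : ae_bounded P (fun w => p w - e (X w)) by exact: ae_bounded_centered.
have fe := cexpP mX fi; set a := cexp P X f in fe.
have [ma ai _] := fe.
have fai : rint P (fun w => f w - a (X w)) by exact: integrable_subr.
have faci : rint P (fun w => (f w - a (X w)) * (p w - e (X w))).
  exact: integrable_aeboundedM.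
have fci : rint P (fun w => f w * (p w - e (X w))).
  exact: integrable_aeboundedM.
have aci : rint P (fun w => a (X w) * (p w - e (X w))).
  exact: (integrable_aeboundedM ai).
have /(is_cexpP mX _ faci)[mC Ci CE] := cexpP mX faci.
apply/(is_cexpP mX _ fci); split => // B mB; rewrite CE//.
rewrite (@eq_Ex _ _ _ _ _ (fun w => f w * (p w - e (X w)) * \1_B (X w)
    - a (X w) * (p w - e (X w)) * \1_B (X w))); last by move=> w; ring.
rewrite RintegralB//; [|exact: integrable_indicX..].
have maB : measurable_fun [set: S] (fun s => a s * \1_B s).
  by apply: measurable_funM => //; exact: measurable_indic.
have aBi := integrable_indicX mX ai mB.
rewrite -[RHS]subr0 -(Ex_centered0 mp bp maB aBi); congr (_ - _).
by apply: eq_Ex => w; rewrite /e; ring.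
Qed.

End ConditionalCovariance.

(** * Additive instruments *)

(** Inversion is continuous on the open complement of zero, and the remaining set is a single
    point. *)
Lemma measurable_invr (R : realType) : measurable_fun [set: R] (@GRing.inv R).
Proof.
have -> : [set: R] = [set 0] `|` ~` [set 0] by rewrite setUv.
apply/measurable_funU => //; first exact: measurableC.
split; first exact: measurable_fun_set1.
apply: open_continuous_measurable_fun.
  by apply: closed_openC; exact: closed_eq.
by move=> x; rewrite inE /= => /eqP x0; exact: inv_continuous.
Qed.

Lemma ae_bounded_inv d (Omega : measurableType d) (R : realType)
    (P : probability Omega R) (f : Omega -> R) (eps : R) :
  0 < eps -> {ae P, forall w, eps <= `|f w|} ->
  ae_bounded P (fun w => (f w)^-1).
Proof.
move=> e0 fe; exists eps^-1; apply: filterS fe => w fe.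
by rewrite normfV lef_pV2 ?posrE// (lt_le_trans e0 fe).
Qed.

Lemma is_cexp_ae_eq d d' (Omega : measurableType d) (S : measurableType d')
    (R : realType) (P : probability Omega R) (X : Omega -> S)
    (f : Omega -> R) (g k : S -> R) :
  measurable_fun [set: Omega] X -> rint P f -> is_cexp P X f g ->
  measurable_fun [set: S] k -> {ae P, forall w, g (X w) = k (X w)} ->
  is_cexp P X f k.
Proof.
move=> mX fi /(is_cexpP mX _ fi)[mg gi gf] mk gk.
have mkX : measurable_fun [set: Omega] (k \o X) by exact: measurableT_comp.
apply/(is_cexpP mX _ fi); split => //; first exact: integrable_ae_eq gk gi.
move=> B mB; rewrite -gf//; apply: ae_eq_Ex.
- by apply: measurable_funM => //; exact: measurable_indicX.
- apply: measurable_funM; last exact: measurable_indicX.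
  exact: measurableT_comp.
- by apply: filterS gk => w ->.
Qed.

Lemma cindep_sym d d1 d2 d' (Omega : measurableType d)
    (S1 : measurableType d1) (S2 : measurableType d2) (S : measurableType d')
    (R : realType) (P : probability Omega R)
    (X1 : Omega -> S1) (X2 : Omega -> S2) (X : Omega -> S) :
  cindep P X1 X2 X -> cindep P X2 X1 X.
Proof.
by move=> i12 B2 B1 mB2 mB1; rewrite setIC; apply: filterS (i12 B1 B2 mB1 mB2)
  => w ->; rewrite mulrC.
Qed.

Section AdditiveInstrument.
Context d dZ dU dH (Omega : measurableType d) (SZ : measurableType dZ)
  (SU : measurableType dU) (SH : measurableType dH) (R : realType)
  (P : probability Omega R) (Z : Omega -> SZ) (U : Omega -> SU)
  (H : Omega -> SH) (A : set Omega) (p : SZ * SH -> R)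
  (b : SU * SH -> R) (c : SZ * SH -> R).
Hypotheses (mZ : measurable_fun [set: Omega] Z)
  (mU : measurable_fun [set: Omega] U) (mH : measurable_fun [set: Omega] H)
  (mA : measurable A) (mp : measurable_fun [set: SZ * SH] p)
  (bp : ae_bounded P (fun w => p (Z w, H w)))
  (iZU : cindep P Z U H)
  (mb : measurable_fun [set: SU * SH] b) (mc : measurable_fun [set: SZ * SH] c)
  (bc : {ae P, forall w, cprob P (fun w => (Z w, (U w, H w))) A
           (Z w, (U w, H w)) = b (U w, H w) + c (Z w, H w)}).

Let UH w := (U w, H w).
Let ZUH w := (Z w, (U w, H w)).
Let e := cexp P H (fun w => p (Z w, H w)).
Let pc w := p (Z w, H w) - e (H w).
Let f w := \1_A w * pc w.

Let mUH : measurable_fun [set: Omega] UH.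
Proof. exact: measurable_fun_pair. Qed.

Let mZH : measurable_fun [set: Omega] (fun w => (Z w, H w)).
Proof. exact: measurable_fun_pair. Qed.

Let mZUH : measurable_fun [set: Omega] ZUH.
Proof. exact: measurable_fun_pair. Qed.

Let mpZH : measurable_fun [set: Omega] (fun w => p (Z w, H w)).
Proof. exact: measurableT_comp mp mZH. Qed.

Let ppi : rint P (fun w => p (Z w, H w)).
Proof. exact: integrable_ae_bounded. Qed.

Let me : measurable_fun [set: SH] e.
Proof. by have [] := cexpP mH ppi. Qed.

Let mpc : measurable_fun [set: Omega] pc.
Proof. exact: measurable_centered. Qed.

Let bpc : ae_bounded P pc.
Proof. exact: ae_bounded_centered. Qed.

Let iA : rint P (\1_A : Omega -> R).
Proof.
exact: (integrable_indic_preimage P (@measurable_id _ Omega setT) mA).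
Qed.

Let fi : rint P f.
Proof. exact: integrable_aeboundedM. Qed.

(* E[p(Z, H) | U, H] = E[p(Z, H) | H] by the IV independence. *)
Let Ex_pc0 (k : SU * SH -> R) : measurable_fun [set: SU * SH] k ->
  rint P (k \o UH) -> Ex P (fun w => pc w * k (UH w)) = 0.
Proof.
move=> mk ki.
have bep : ae_bounded P (fun w => e (H w)).
  exact: (is_cexp_ae_bounded mH ppi bp (cexpP mH ppi)).
have meH : measurable_fun [set: Omega] (e \o H) by exact: measurableT_comp.
have pki : rint P (fun w => p (Z w, H w) * k (UH w)).
  under eq_fun do rewrite mulrC.
  exact: (integrable_aeboundedM ki).
have eki : rint P (fun w => e (H w) * k (UH w)).
  under eq_fun do rewrite mulrC.
  exact: (integrable_aeboundedM ki).
have pe := cindep_cexp mZ mU mH iZU mp ppi.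
rewrite (@eq_Ex _ _ _ _ _ (fun w =>
    p (Z w, H w) * k (UH w) - e (H w) * k (UH w))); last first.
  by move=> w; rewrite /pc mulrBl.
by rewrite RintegralB// (Ex_cexp mUH ppi pe mk)// subrr.
Qed.

Let m := cexp P UH f.

Let fm : is_cexp P UH f m.
Proof. exact: cexpP. Qed.

Let K (n : nat) := [set x : SU * SH | `|b x| <= n%:R].

Let mK n : measurable (K n).
Proof.
rewrite [K n](_ : _ = setT `&` (fun x => `|b x| <= n%:R) @^-1` [set true]).
  apply: measurable_fun_ler => //; exact: measurableT_comp.
by rewrite setTI.
Qed.

(* Where |b| <= n also |c| <= n + C, so both summands may be truncated. *)
Let truncated_version n : exists2 k : SH -> R, measurable_fun [set: SH] k &
  {ae P, forall w, m (UH w) * \1_(K n) (UH w) = k (H w) * \1_(K n) (UH w)}.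
Proof.
have pr := cexpP mZUH iA; rewrite -/(cprob P ZUH A) in pr.
set q := cprob P ZUH A in pr; have [mq qi _] := pr.
have bA : ae_bounded P (\1_A : Omega -> R) by exact: ae_bounded_indic_set.
have [C qC] := is_cexp_ae_bounded mZUH iA bA pr.
pose M := [set x : SZ * SH | `|c x| <= n%:R + C].
have mM : measurable M.
  rewrite [M](_ : _ = setT `&` (fun x => `|c x| <= n%:R + C) @^-1` [set true]).
    apply: measurable_fun_ler => //; exact: measurableT_comp.
  by rewrite setTI.
pose cn x := c x * \1_M x.
have mcn : measurable_fun [set: SZ * SH] cn.
  by apply: measurable_funM => //; exact: measurable_indic.
have cnb x : `|cn x| <= `|n%:R + C|.
  rewrite /cn normrM indicE; have [|_] := boolP (x \in M).
    by rewrite inE /M /= normr1 mulr1 => /le_trans; apply; exact: ler_norm.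
  by rewrite normr0 mulr0.
pose phi x := (p x - e x.2) * cn x.
have mphi : measurable_fun [set: SZ * SH] phi.
  apply: measurable_funM => //; apply: measurable_funB => //.
  exact: measurableT_comp me (@measurable_snd _ _ _ _).
have bphi : ae_bounded P (fun w => phi (Z w, H w)).
  by apply: ae_boundedM => //; apply: ae_bounded_le => w; exact: cnb.
have phii : rint P (fun w => phi (Z w, H w)).
  by apply: integrable_ae_bounded => //; exact: measurableT_comp mphi mZH.
(* The witness is built from the [c]-part alone: the conditional mean given [H] of the centered
   weight times the truncated [c]. *)
set g := cexp P H (fun w => phi (Z w, H w)).
have [mg gi _] := cexpP mH phii; rewrite -/g in mg gi.
have pg := cindep_cexp mZ mU mH iZU mphi phii; rewrite -/g in pg.
exists g => //.
have [mm mi mE] := (is_cexpP mUH _ fi).1 fm.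
have mgs : measurable_fun [set: SU * SH] (g \o snd).
  exact: measurableT_comp mg (@measurable_snd _ _ _ _).
apply: (@eq_ae_of_Ex _ _ _ _ _ P UH mUH (fun x => m x * \1_(K n) x)
    (fun x => g x.2 * \1_(K n) x)).
- by apply: measurable_funM => //; exact: measurable_indic.
- by apply: measurable_funM => //; exact: measurable_indic.
- exact: (integrable_indicX mUH mi).
- exact: (integrable_indicX mUH gi).
(* Absorbing the truncation into the test set keeps [b] bounded wherever it occurs below. *)
move=> B mB; pose E := K n `&` B.
have mE' : measurable E by exact: measurableI.
have EE w : \1_E (UH w) = \1_(K n) (UH w) * \1_B (UH w) :> R by rewrite indicI.
have m1E : measurable_fun [set: SU * SH] (\1_E : _ -> R).
  exact: measurable_indic.
have b1E : ae_bounded P (fun w => \1_E (UH w) : R) by exact: ae_bounded_indic.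
have m1EX := measurable_indicX (R := R) mUH mE'.
transitivity (Ex P (fun w => m (UH w) * \1_E (UH w))).
  by apply: eq_Ex => w; rewrite EE mulrA.
transitivity (Ex P (fun w => g (H w) * \1_E (UH w))); last first.
  by apply: eq_Ex => w; rewrite EE mulrA.
rewrite mE//.
(* All of the integrand except [1_A] is a function of [(Z, U, H)], so [1_A] may be replaced by its
   conditional probability [q]. *)
pose kap (x : SZ * (SU * SH)) := (p (x.1, x.2.2) - e x.2.2) * \1_E x.2.
have mkap : measurable_fun [set: SZ * (SU * SH)] kap.
  have m22 : measurable_fun [set: SZ * (SU * SH)] (fun x => x.2.2).
    exact: measurableT_comp (@measurable_snd _ _ _ _) (@measurable_snd _ _ _ _).
  have m122 : measurable_fun [set: SZ * (SU * SH)] (fun x => (x.1, x.2.2)).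
    by apply: measurable_fun_pair => //; exact: measurable_fst.
  apply: (measurable_funM (measurable_funB (measurableT_comp mp m122)
    (measurableT_comp me m22))).
  exact: measurableT_comp m1E (@measurable_snd _ _ _ _).
have bkap : ae_bounded P (kap \o ZUH) by exact: ae_boundedM.
have mkapX : measurable_fun [set: Omega] (kap \o ZUH).
  exact: measurableT_comp.
transitivity (Ex P (fun w => \1_A w * kap (ZUH w))).
  by apply: eq_Ex => w; rewrite /f /kap /pc /= mulrA.
rewrite (Ex_cexp mZUH iA pr mkap); last 2 first.
- exact: integrable_aeboundedM.
- exact: (integrable_aeboundedM qi).
pose bE x := b x * \1_E x.
have mbE : measurable_fun [set: SU * SH] bE by exact: measurable_funM.
have mbEX : measurable_fun [set: Omega] (bE \o UH) by exact: measurableT_comp.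
have bEb : ae_bounded P (bE \o UH).
  apply: (@ae_bounded_le _ _ _ _ _ n%:R) => w; rewrite /bE /= normrM indicE.
  have [|_] := boolP (UH w \in E); last by rewrite normr0 mulr0.
  by rewrite inE => -[]; rewrite /K /= normr1 mulr1.
have pbi : rint P (fun w => pc w * bE (UH w)).
  by apply: integrable_ae_bounded; [exact: measurable_funM|exact: ae_boundedM].
have phE : rint P (fun w => phi (Z w, H w) * \1_E (UH w)).
  exact: integrable_indicX.
(* Substituting [q = b + c]: the [b] term has mean zero by [Ex_pc0], and the conditional expectation
   of the [c] term given [(U, H)] is [g(H)] by [cindep_cexp]. *)
transitivity (Ex P (fun w => pc w * bE (UH w) + phi (Z w, H w) * \1_E (UH w))).
  apply: ae_eq_Ex.
  - by apply: measurable_funM => //; exact: measurableT_comp.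
  - exact: integrable_measurable (integrable_addr pbi phE).
  - apply: filterS2 qC bc => w /= qC; rewrite -/ZUH -/q -/(ZUH w) => qE.
    rewrite /kap /phi /bE /cn /pc /ZUH /UH /=.
    have [EU|EU] := boolP (UH w \in E); last first.
      have -> : \1_E (U w, H w) = 0 :> R by rewrite indicE (negbTE EU).
      by rewrite !mulr0 addr0.
    have -> : \1_M (Z w, H w) = 1 :> R.
      rewrite indicE mem_set// /M /=.
      rewrite (_ : c _ = q (ZUH w) - b (UH w)); last by rewrite qE; ring.
      rewrite [n%:R + C]addrC (le_trans (ler_normB _ _))// lerD//.
      by move: EU; rewrite inE => -[].
    by move: qE; rewrite /ZUH => ->; ring.
rewrite RintegralD//.
have mbEi : rint P (bE \o UH) by exact: integrable_ae_bounded.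
rewrite (Ex_pc0 mbE mbEi) add0r.
by rewrite (Ex_cexp mUH phii pg m1E)//; exact: (integrable_indicX mUH gi mE').
Qed.

(** The sets [K n] exhaust the space, so the functions [k_ n] of [H] obtained on them can be glued
    into one function of [H]. *)
Let cexp_factors : exists2 k : SH -> R, measurable_fun [set: SH] k &
  {ae P, forall w, m (UH w) = k (H w)}.
Proof.
have /choice[k_ k_P] (n : nat) : exists k : SH -> R,
    measurable_fun [set: SH] k /\
    {ae P, forall w, m (UH w) * \1_(K n) (UH w) = k (H w) * \1_(K n) (UH w)}.
  by have [k mk kE] := truncated_version n; exists k.
(* The upper limit is measurable and defined at every [s], including those where the sequence fails
   to converge. *)
pose k s := fine (limn_esup (fun n => (k_ n s)%:E)).
exists k.
  apply: measurableT_comp => //; apply: measurable_fun_limn_esup => n.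
  by apply/measurable_EFinP; have [] := k_P n.
have := ae_foralln (fun n => (k_P n).2).
apply: filterS => w kE.
have k_cvg : (fun n => (k_ n (H w))%:E) @ \oo --> (m (UH w))%:E.
  (* Once [n] exceeds [|b|] at the given point the truncation is inactive, so the sequence is
     constant from there on. *)
  apply: cvg_near_cst; exists (Num.truncn `|b (UH w)|).+1 => // n /= bn.
  have Kn : UH w \in K n.
    rewrite inE /K /= (le_trans (ltW (truncnS_gt _)))// ler_nat//.
  by have := kE n; rewrite indicE Kn !mulr1 => ->.
by rewrite /k (cvg_limn_einf_sup k_cvg).2.
Qed.

(** By [cexp_factors], [E[f | U, H]] is some [k(H)]. Testing on [setT * B] shows that [k] is also a
    version of [E[f | H]], which [is_cexp_ccov] identifies with the conditional covariance;
    uniqueness concludes. *)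
Lemma additive_IV_cexp :
  is_cexp P UH f (ccov P H \1_A (fun w => p (Z w, H w)) \o snd).
Proof.
have [k mk mkE] := cexp_factors.
have Cf : is_cexp P H f (ccov P H \1_A (fun w => p (Z w, H w))).
  exact: is_cexp_ccov.
have [mC _ _] := Cf.
have [mm mi mE] := (is_cexpP mUH _ fi).1 fm.
have mkH : measurable_fun [set: Omega] (k \o H) by exact: measurableT_comp.
have ki : rint P (k \o H) by exact: integrable_ae_eq mkH mkE mi.
have kf : is_cexp P H f k.
  apply/(is_cexpP mH _ fi); split => // B mB.
  have mTB : measurable ([set: SU] `*` B) by exact: measurableX.
  have TBE w : \1_([set: SU] `*` B) (UH w) = \1_B (H w) :> R.
    by rewrite indic_setX indicT mul1r.
  have := mE _ mTB; under [in RHS]eq_Ex do rewrite TBE.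
  move=> <-; apply: ae_eq_Ex.
  - by apply: measurable_funM => //; exact: measurable_indicX.
  - apply: measurable_funM; last exact: measurable_indicX.
    exact: measurableT_comp.
  - by apply: filterS mkE => w <-; rewrite TBE.
apply: is_cexp_ae_eq fm _ _ => //.
  exact: measurableT_comp mC (@measurable_snd _ _ _ _).
by apply: filterS2 mkE (is_cexp_ae_unique mH fi kf Cf) => w -> kC; exact: kC.
Qed.

End AdditiveInstrument.

(** * Longitudinal data *)

(** Applied with [V = (Z_t, A_t)], [F] the indicator times the centered weight, and [C] its
    covariance. First [Y] is replaced by [M = E[Y | H, U]], then [F] by [C(H)], which cancels the
    denominator, and finally [M] is turned back into [Y]. *)
Lemma Ex_weighted d dV dU dH (Omega : measurableType d) (SV : measurableType dV)
    (SU : measurableType dU) (SH : measurableType dH) (R : realType)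
    (P : probability Omega R) (V : Omega -> SV) (U : Omega -> SU)
    (H : Omega -> SH) (Y : Omega -> R) (F : SV * SH -> R) (C g : SH -> R)
    (eps : R) :
  measurable_fun [set: Omega] V -> measurable_fun [set: Omega] U ->
  measurable_fun [set: Omega] H -> rint P Y ->
  cindep P V Y (fun w => (H w, U w)) ->
  measurable_fun [set: SV * SH] F -> ae_bounded P (fun w => F (V w, H w)) ->
  measurable_fun [set: SH] C -> 0 < eps ->
  {ae P, forall w, eps <= `|C (H w)|} ->
  is_cexp P (fun w => (U w, H w)) (fun w => F (V w, H w)) (C \o snd) ->
  measurable_fun [set: SH] g -> ae_bounded P (g \o H) ->
  Ex P (fun w => F (V w, H w) / C (H w) * (g (H w) * Y w)) =
  Ex P (fun w => g (H w) * Y w).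
Proof.
move=> mV mU mH Yi iVY mF bF mC e0 eC CF mg bg.
have mHU : measurable_fun [set: Omega] (fun w => (H w, U w)).
  exact: measurable_fun_pair.
have mUH : measurable_fun [set: Omega] (fun w => (U w, H w)).
  exact: measurable_fun_pair.
have mVH : measurable_fun [set: Omega] (fun w => (V w, H w)).
  exact: measurable_fun_pair.
have mVHU : measurable_fun [set: Omega] (fun w => (V w, (H w, U w))).
  exact: measurable_fun_pair.
have mY := integrable_measurable Yi.
have mFX : measurable_fun [set: Omega] (fun w => F (V w, H w)).
  exact: measurableT_comp mF mVH.
have Fi : rint P (fun w => F (V w, H w)) by exact: integrable_ae_bounded.
have YM := cexpP mHU Yi; set M := cexp P _ Y in YM.
have [mM Mi _] := YM.
(* Ignorability, read from the side of [Y]: conditioning additionally on [V] leaves [M]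
   unchanged. *)
have YM' := cindep_cexp mY mV mHU (cindep_sym iVY)
  (@measurable_fst _ _ R (SH * SU)%type) Yi.
rewrite -/M in YM'.
pose gC h := g h / C h.
have mgC : measurable_fun [set: SH] gC.
  by apply: measurable_funM => //;
    exact: measurableT_comp (@measurable_invr R) mC.
have bgC : ae_bounded P (gC \o H).
  by apply: ae_boundedM => //; exact: ae_bounded_inv eC.
have mgCX : measurable_fun [set: Omega] (gC \o H) by exact: measurableT_comp.
have mgX : measurable_fun [set: Omega] (g \o H) by exact: measurableT_comp.
pose kap (x : SV * (SH * SU)) := F (x.1, x.2.1) * gC x.2.1.
have m21 : measurable_fun [set: SV * (SH * SU)] (fun x => x.2.1).
  exact: measurableT_comp (@measurable_fst _ _ _ _) (@measurable_snd _ _ _ _).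
have m121 : measurable_fun [set: SV * (SH * SU)] (fun x => (x.1, x.2.1)).
  by apply: measurable_fun_pair => //; exact: measurable_fst.
have mkap : measurable_fun [set: SV * (SH * SU)] kap.
  exact: measurable_funM (measurableT_comp mF m121) (measurableT_comp mgC m21).
have bFg : ae_bounded P (fun w => F (V w, H w) * gC (H w)).
  exact: ae_boundedM.
have mFg : measurable_fun [set: Omega] (fun w => F (V w, H w) * gC (H w)).
  exact: measurable_funM.
transitivity (Ex P (fun w => Y w * kap (V w, (H w, U w)))).
  by apply: eq_Ex => w; rewrite /kap /gC /=; ring.
rewrite (Ex_cexp mVHU Yi YM' mkap); last 2 first.
- exact: (integrable_aeboundedM Yi).
- exact: (integrable_aeboundedM Mi).
pose k (x : SU * SH) := M (x.2, x.1) * gC x.2.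
have msw : measurable_fun [set: SU * SH] (fun x => (x.2, x.1)).
  by apply: measurable_fun_pair; [exact: measurable_snd|exact: measurable_fst].
have mk : measurable_fun [set: SU * SH] k.
  apply: measurable_funM; first exact: measurableT_comp mM msw.
  exact: measurableT_comp mgC (@measurable_snd _ _ _ _).
have MgCi : rint P (fun w => M (H w, U w) * gC (H w)).
  exact: (integrable_aeboundedM Mi).
have bC : ae_bounded P (fun w => C (H w)).
  exact: (is_cexp_ae_bounded mUH Fi bF CF).
have mCX : measurable_fun [set: Omega] (C \o H) by exact: measurableT_comp.
transitivity (Ex P (fun w => F (V w, H w) * k (U w, H w))).
  by apply: eq_Ex => w; rewrite /kap /k /=; ring.
rewrite (Ex_cexp mUH Fi CF mk); last 2 first.
- by under eq_fun do rewrite mulrC; exact: (integrable_aeboundedM MgCi).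
- by under eq_fun do rewrite mulrC; exact: (integrable_aeboundedM MgCi).
transitivity (Ex P (fun w => M (H w, U w) * g (H w))).
  apply: ae_eq_Ex.
  - apply: measurable_funM => //; exact: (integrable_measurable MgCi).
  - by apply: measurable_funM => //; exact: (integrable_measurable Mi).
  - apply: filterS eC => w eC; rewrite /k /gC /=.
    have C0 : C (H w) != 0 by rewrite -normr_gt0 (lt_le_trans e0).
    by field.
rewrite -(Ex_cexp mHU Yi YM (measurableT_comp mg (@measurable_fst _ _ _ _))).
- by apply: eq_Ex => w; rewrite mulrC.
- exact: (integrable_aeboundedM Yi).
- exact: (integrable_aeboundedM Mi).
Qed.

Section Longitudinal.
Context d (Omega : measurableType d) (R : realType) (P : probability Omega R)
  (T : nat) (D : longData Omega R T).

Lemma measurable_hist t : measurable_fun [set: Omega] (hist D t).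
Proof.
elim: t => [|t IH] /=; first exact: measurable_funPT.
apply: measurable_fun_pair; last exact: measurable_funPT.
apply: measurable_fun_pair => //.
by apply: measurable_fun_pair; exact: measurable_funPT.
Qed.

Lemma measurable_latUbar t : measurable_fun [set: Omega] (latUbar D t).
Proof.
elim: t => [|t IH] /=; first exact: measurable_funPT.
by apply: measurable_fun_pair => //; exact: measurable_funPT.
Qed.

Lemma measurable_trt t (b : typA D t) : measurable [set w | trtA D t w = b].
Proof.
have := @measurable_funPTI _ _ _ _ (trtA D t) [set b] (measurable_discrete _).
by [].
Qed.

Lemma trtIE t (b : typA D t) w : trtI b w = \1_[set b] (trtA D t w) :> R.
Proof. exact: (indic_preimage R (trtA D t) [set b] w). Qed.

Lemma integrable_trtI t (b : typA D t) : rint P (trtI b : Omega -> R).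
Proof.
exact: (integrable_indic_preimage P (@measurable_id _ Omega setT)
  (measurable_trt b)).
Qed.

Lemma ae_bounded_trtI t (b : typA D t) : ae_bounded P (trtI b : Omega -> R).
Proof. exact: ae_bounded_indic_set. Qed.

Hypothesis potYi : forall abar : {dffun forall t : 'I_T.+1, typA D t},
  rint P (potY D abar).
Variable a : forall t, typA D t.

(** There are finitely many regimes, so [Y(A_0..A_(t-1), a_t..)] is a finite sum of the integrable
    [potY D x], each restricted to the event that the mixed regime equals [x]. *)
Lemma integrable_potYfrom t : rint P (potYfrom a t).
Proof.
pose b w : {dffun forall t : 'I_T.+1, typA D t} :=
  [ffun i : 'I_T.+1 => if (i < t)%N then trtA D i w else a i].
have mb x : measurable [set w | b w = x].
  rewrite [X in measurable X](_ : _ =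
      \bigcap_(i in [set: 'I_T.+1]) [set w | b w i = x i]); last first.
    apply/seteqP; split=> [w bx i _|w bx]; first by rewrite /= -bx.
    by apply/ffunP => i; exact: (bx i I).
  apply: fin_bigcap_measurable => // i _.
  have [it|it] := boolP (i < t)%N.
    rewrite [X in measurable X](_ : _ = [set w | trtA D i w = x i]).
      exact: measurable_trt.
    by apply/seteqP; split=> w /=; rewrite ffunE it.
  have [ax|ax] := pselect (a i = x i).
    rewrite [X in measurable X](_ : _ = setT)//.
    by apply/seteqP; split=> w //= _; rewrite ffunE (negbTE it).
  rewrite [X in measurable X](_ : _ = set0)//.
  by apply/seteqP; split=> w //=; rewrite ffunE (negbTE it).
rewrite [X in P.-integrable _ X](_ : _ = (fun w =>
    \sum_(x : {dffun forall t : 'I_T.+1, typA D t})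
      (potY D x w * \1_[set w | b w = x] w)%:E)%E); last first.
  apply/funext => w; rewrite sumEFin; congr (_%:E).
  rewrite (bigD1 (b w))//= indicE mem_set// mulr1 big1 ?addr0// => x xb.
  by rewrite indicE memNset ?mulr0//= => bx; case/eqP: xb.
apply: integrable_sum => // x _.
apply: (integrable_aeboundedM (potYi x));
  first exact: (measurable_indic (mb x)).
exact: ae_bounded_indic_set.
Qed.

(** The two regimes can differ only at time [t]. This is what the indicator in the weight is for. *)
Lemma potYfrom_trt t w : trtA D t w = a t -> potYfrom a t.+1 w = potYfrom a t w.
Proof.
move=> wt; rewrite /potYfrom; congr (potY D _ w); apply/ffunP => i.
rewrite !ffunE ltnS leq_eqVlt; case: eqP => //= it.
by case: i it => i li /= it; subst i; rewrite ltnn wt.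
Qed.

End Longitudinal.

(** * Identification by recursion over the times *)

Section Identification.
Context d (Omega : measurableType d) (R : realType) (P : probability Omega R)
  (T : nat) (D : longData Omega R T)
  (pi : forall t : nat, typZ D t * typH D t -> R)
  (a : forall t : nat, typA D t).
Arguments pi : clear implicits.
Hypotheses (potYi : forall abar : {dffun forall t : 'I_T.+1, typA D t},
    rint P (potY D abar))
  (consY : consistency D P) (ignY : latent_ignorability D P)
  (ivU : IV_independence D P)
  (addIV : forall t : nat, (t <= T)%N -> additive_IV D P t)
  (regW : forall t : nat, (t <= T)%N -> regular_weight P (pi t)).

Let e t := cexp P (hist D t) (weightRV (pi t)).
Let C t := ccov P (hist D t) (trtI (a t)) (weightRV (pi t)).
Let pc t w := weightRV (pi t) w - e (hist D t w).
Let W t w := pc t w * trtI (a t) w / C (hist D t w).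

Let mH t : measurable_fun [set: Omega] (hist D t).
Proof. exact: measurable_hist. Qed.

Let mU t : measurable_fun [set: Omega] (latUbar D t).
Proof. exact: measurable_latUbar. Qed.

Let mZ t : measurable_fun [set: Omega] (insZ D t).
Proof. exact: measurable_funPT. Qed.

(* E[y | H_t] = E[Y(a_t..) | H_t] *)
Definition matches_potYfrom t (y : Omega -> R) : Prop := rint P y /\
  forall g : typH D t -> R, measurable_fun [set: typH D t] g ->
    ae_bounded P (g \o hist D t) ->
    Ex P (fun w => y w * g (hist D t w)) =
    Ex P (fun w => g (hist D t w) * potYfrom a t w).

Section AtTime.
Variable t : nat.
Hypothesis tT : (t <= T)%N.

Let mpi : measurable_fun [set: typZ D t * typH D t] (pi t).
Proof. by have [] := regW tT. Qed.

Let mwt : measurable_fun [set: Omega] (weightRV (pi t)).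
Proof. exact: measurableT_comp mpi (measurable_fun_pair (@mZ t) (@mH t)). Qed.

Let bwt : ae_bounded P (weightRV (pi t)).
Proof.
by have [_ [M piM] _] := regW tT; apply: (@ae_bounded_le _ _ _ _ _ M) => w;
  exact: piM.
Qed.

Let iwt : rint P (weightRV (pi t)).
Proof. exact: integrable_ae_bounded. Qed.

Let me : measurable_fun [set: typH D t] (@e t).
Proof. by have [] := cexpP (@mH t) iwt. Qed.

Let mpc : measurable_fun [set: Omega] (pc t).
Proof. exact: (measurable_centered (@mH t) mwt bwt). Qed.

Let bpc : ae_bounded P (pc t).
Proof. exact: (ae_bounded_centered (@mH t) mwt bwt). Qed.

Let mtrt : measurable_fun [set: Omega] (trtI (a t) : Omega -> R).
Proof. exact: integrable_measurable (integrable_trtI P (a t)). Qed.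

Let mC : measurable_fun [set: typH D t] (@C t).
Proof.
by have [] := is_cexp_ccov (@mH t) (integrable_trtI P (a t)) mwt bwt.
Qed.

Let mCV : measurable_fun [set: Omega] (fun w => (C (hist D t w))^-1).
Proof.
exact: measurableT_comp (@measurable_invr R) (measurableT_comp mC (@mH t)).
Qed.

Let bCV : ae_bounded P (fun w => (C (hist D t w))^-1).
Proof.
by have [_ _ /(_ (a t))[eps e0 eC]] := regW tT; exact: ae_bounded_inv eC.
Qed.

Lemma ae_bounded_W : ae_bounded P (W t).
Proof.
by do 2 apply: ae_boundedM => //; exact: ae_bounded_trtI.
Qed.

(** The history at [t.+1] records [H_t], [Z_t] and [A_t], so a weight may enter a test function at
    any later time. *)
Lemma W_hist : exists2 V : typH D t.+1 -> R,
  measurable_fun [set: typH D t.+1] V &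
  forall w, W t w = V (hist D t.+1 w).
Proof.
pose S := (typH D t * (typZ D t * typA D t) * typL D t.+1)%type.
exists (fun s : S => (pi t (s.1.2.1, s.1.1) - e s.1.1)
    * \1_[set a t] s.1.2.2 / C s.1.1); last first.
  by move=> w; rewrite /W /pc trtIE.
have m1 : measurable_fun [set: S] (fun s => s.1) by exact: measurable_fst.
have m11 : measurable_fun [set: S] (fun s => s.1.1).
  exact: measurableT_comp (@measurable_fst _ _ _ _) m1.
have m12 : measurable_fun [set: S] (fun s => s.1.2).
  exact: measurableT_comp (@measurable_snd _ _ _ _) m1.
have m121 : measurable_fun [set: S] (fun s => s.1.2.1).
  exact: measurableT_comp (@measurable_fst _ _ _ _) m12.
have m122 : measurable_fun [set: S] (fun s => s.1.2.2).
  exact: measurableT_comp (@measurable_snd _ _ _ _) m12.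
apply: measurable_funM; last first.
  exact: measurableT_comp (@measurable_invr R) (measurableT_comp mC m11).
apply: measurable_funM; last first.
  exact: measurableT_comp (measurable_indic (measurable_discrete _)) m122.
apply: measurable_funB; last exact: measurableT_comp me m11.
exact: measurableT_comp mpi (measurable_fun_pair m121 m11).
Qed.

(** Ignorability at time [t] concerns [Y(a_t..)], so [Ex_weighted] is applied to that variable; it
    is then exchanged for [Y(a_(t+1)..)] on the event selected by the indicator. *)
Lemma Ex_weight_step (g : typH D t -> R) :
  measurable_fun [set: typH D t] g -> ae_bounded P (g \o hist D t) ->
  Ex P (fun w => W t w * (g (hist D t w) * potYfrom a t.+1 w)) =
  Ex P (fun w => g (hist D t w) * potYfrom a t w).
Proof.
move=> mg bg.
have [b [c [mb mc bcE]]] := addIV tT (a t).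
have bp : ae_bounded P (fun w => pi t (insZ D t w, hist D t w)) by exact: bwt.
have CF := additive_IV_cexp (@mZ t) (@mU t) (@mH t)
  (measurable_trt (a t)) mpi bp (ivU tT) mb mc bcE.
have [_ _ /(_ (a t))[eps e0 eC]] := regW tT.
pose F (x : typZ D t * typA D t * typH D t) :=
  \1_[set a t] x.1.2 * (pi t (x.1.1, x.2) - e x.2).
have mV : measurable_fun [set: Omega] (fun w => (insZ D t w, trtA D t w)).
  by apply: measurable_fun_pair => //; exact: measurable_funPT.
have m1 : measurable_fun [set: typZ D t * typA D t * typH D t] (fun x => x.1).
  exact: measurable_fst.
have m2 : measurable_fun [set: typZ D t * typA D t * typH D t] (fun x => x.2).
  exact: measurable_snd.
have m11 : measurable_fun [set: typZ D t * typA D t * typH D t]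
    (fun x => x.1.1).
  exact: measurableT_comp (@measurable_fst _ _ _ _) m1.
have m12 : measurable_fun [set: typZ D t * typA D t * typH D t]
    (fun x => x.1.2).
  exact: measurableT_comp (@measurable_snd _ _ _ _) m1.
have mF : measurable_fun [set: typZ D t * typA D t * typH D t] F.
  apply: measurable_funM.
    exact: measurableT_comp (measurable_indic (measurable_discrete _)) m12.
  apply: measurable_funB; last exact: measurableT_comp me m2.
  exact: measurableT_comp mpi (measurable_fun_pair m11 m2).
have FE w : F ((insZ D t w, trtA D t w), hist D t w) = trtI (a t) w * pc t w.
  by rewrite trtIE.
have bF : ae_bounded P (fun w => F ((insZ D t w, trtA D t w), hist D t w)).
  rewrite (_ : (fun w => _) = (fun w => trtI (a t) w * pc t w));
    last exact/funext.
  by apply: ae_boundedM => //; exact: ae_bounded_trtI.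
have CF' : is_cexp P (fun w => (latUbar D t w, hist D t w))
    (fun w => F ((insZ D t w, trtA D t w), hist D t w)) (@C t \o snd).
  by rewrite (_ : (fun w => F _) = (fun w => trtI (a t) w * pc t w));
    last exact/funext.
rewrite -(Ex_weighted mV (@mU t) (@mH t)
  (integrable_potYfrom potYi a t) (ignY a tT) mF bF mC e0 eC CF' mg bg).
apply: eq_Ex => w; rewrite FE /W trtIE indicE.
have [|_] := boolP (trtA D t w \in [set a t]); last by rewrite mulr0 !mul0r.
by rewrite inE /= => wa; rewrite (potYfrom_trt wa); ring.
Qed.

(** The new variable is a version of [E[W_t y | H_t]]. Tested against [g], it becomes [y] tested
    against [W_t g], a function of the next history to which the assumption on [y] applies;
    [Ex_weight_step] then removes [W_t]. *)
Lemma matches_gamma_step (y : Omega -> R) : matches_potYfrom t.+1 y ->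
  matches_potYfrom t (fun w =>
    ccov P (hist D t) (fun w' => trtI (a t) w' * y w') (weightRV (pi t))
      (hist D t w) / C (hist D t w)).
Proof.
move=> [yi yE]; pose f w := trtI (a t) w * y w.
have fi : rint P f.
  rewrite /f; under eq_fun do rewrite mulrC.
  by apply: integrable_aeboundedM => //; exact: ae_bounded_trtI.
have fC := is_cexp_ccov (@mH t) fi mwt bwt.
set cc := ccov _ _ _ _ in fC *; have [mcc cci _] := fC.
split; first exact: (integrable_aeboundedM cci mCV bCV).
move=> g mg bg; have [V mV VE] := W_hist.
pose G (s : typH D t.+1) := V s * g s.1.1.
have mgH : measurable_fun [set: Omega] (g \o hist D t).
  exact: measurableT_comp mg (@mH t).
have mG : measurable_fun [set: typH D t.+1] G.
  apply: (measurable_funM mV); apply: measurableT_comp mg _.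
  exact: measurableT_comp (@measurable_fst _ _ _ _) (@measurable_fst _ _ _ _).
have bG : ae_bounded P (G \o hist D t.+1).
  rewrite (_ : G \o _ = (fun w => W t w * g (hist D t w))).
    by apply: ae_boundedM => //; exact: ae_bounded_W.
  by apply/funext => w; rewrite VE.
pose gC h := g h / C h.
have mgC : measurable_fun [set: typH D t] gC.
  by apply: measurable_funM => //;
    exact: measurableT_comp (@measurable_invr R) mC.
have bgC : ae_bounded P (fun w => gC (hist D t w)) by exact: ae_boundedM.
have mgCH : measurable_fun [set: Omega] (fun w => gC (hist D t w)).
  exact: measurableT_comp mgC (@mH t).
have fpci : rint P (fun w => f w * pc t w) by exact: integrable_aeboundedM.
transitivity (Ex P (fun w => cc (hist D t w) * gC (hist D t w))).
  by apply: eq_Ex => w; rewrite /gC; ring.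
rewrite -(Ex_cexp (@mH t) fpci fC mgC); last 2 first.
- exact: integrable_aeboundedM.
- exact: (integrable_aeboundedM cci).
transitivity (Ex P (fun w => y w * G (hist D t.+1 w))).
  by apply: eq_Ex => w; rewrite /G -VE /f /gC /W /=; ring.
rewrite (yE _ mG bG) -(Ex_weight_step mg bg).
by apply: eq_Ex => w; rewrite /G -VE /=; ring.
Qed.

End AtTime.

(** At [T.+1] every treatment is the observed one, so consistency gives almost sure equality with
    [outY]. The identity therefore holds against any test function, here one of [hist D T.+1], which
    ends with a member [L_(T+1)] where the text has [Y]. *)
Lemma matches_outY : matches_potYfrom T.+1 (outY D).
Proof.
have YE : {ae P, forall w, potYfrom a T.+1 w = outY D w}.
  apply: filterS consY => w ->; rewrite /potYfrom; congr (potY D _ w).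
  by apply/ffunP => i; rewrite !ffunE ltn_ord.
have Yi := integrable_potYfrom potYi a T.+1.
have mY : measurable_fun [set: Omega] (outY D) by exact: measurable_funPT.
split; first exact: integrable_ae_eq mY YE Yi.
move=> g mg bg.
have mgH : measurable_fun [set: Omega] (g \o hist D T.+1).
  exact: measurableT_comp mg (@mH _).
apply: ae_eq_Ex.
- exact: measurable_funM.
- by apply: measurable_funM => //; exact: integrable_measurable Yi.
- by apply: filterS YE => w ->; rewrite mulrC.
Qed.

Lemma matches_gammaT1B k t : (t + k)%N = T.+1 ->
  matches_potYfrom t (gammaT1B P pi a k).
Proof.
elim: k t => [t|j IH t tj].
  by rewrite addn0 => ->; exact: matches_outY.
(* Level [j.+1] of [gammaT1B] lives at time [T - j]; substituting this for [t] makes the dependent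
   types agree. *)
have tE : t = (T - j)%N by rewrite -subSS -tj addnK.
subst t; apply: matches_gamma_step; first exact: leq_subr.
by apply: IH; rewrite addSnnS.
Qed.

(** Makes the partial product an admissible test function at its end time. The form [n + s] lets
    [n.+1 + s] reduce to a successor, so that [typH] unfolds in the induction. *)
Lemma weight_prod_hist s n : (n + s <= T.+1)%N ->
  exists V : typH D (n + s) -> R,
  [/\ measurable_fun [set: typH D (n + s)] V,
      ae_bounded P (V \o hist D (n + s)) &
      forall w, \prod_(s <= t < n + s) W t w = V (hist D (n + s) w)].
Proof.
elim: n => [_|n IH nT].
  exists (cst 1); split => // [|w]; last by rewrite big_geq.
  by apply: (@ae_bounded_le _ _ _ _ _ 1) => w; rewrite /= normr1.
have [V [mV bV VE]] := IH (ltnW nT).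
have [V' mV' VE'] := W_hist nT.
exists (fun s => V s.1.1 * V' s).
have WE w : \prod_(s <= t < n.+1 + s) W t w =
    V (hist D (n + s) w) * W (n + s) w.
  by rewrite big_nat_recr ?leq_addl//= VE.
split.
- apply: measurable_funM => //; apply: measurableT_comp mV _.
  exact: measurableT_comp (@measurable_fst _ _ _ _) (@measurable_fst _ _ _ _).
- rewrite (_ : _ \o _ = (fun w => V (hist D (n + s) w) * W (n + s) w)).
    by apply: ae_boundedM => //; exact: ae_bounded_W.
  by apply/funext => w; rewrite VE'.
- by move=> w; rewrite WE VE'.
Qed.

(** The last factor is removed by [Ex_weight_step], with the product of the earlier ones as test
    function. *)
Lemma Ex_weight_prod s n : (n + s <= T.+1)%N ->
  Ex P (fun w => (\prod_(s <= t < n + s) W t w) * potYfrom a (n + s) w) =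
  Ex P (potYfrom a s).
Proof.
elim: n => [_|n IH nT].
  by apply: eq_Ex => w; rewrite big_geq// mul1r.
rewrite -(IH (ltnW nT)).
have [V [mV bV VE]] := weight_prod_hist (ltnW nT).
transitivity (Ex P (fun w => V (hist D (n + s) w) * potYfrom a (n + s) w)).
  rewrite -(Ex_weight_step nT mV bV); apply: eq_Ex => w.
  by rewrite big_nat_recr ?leq_addl//= VE; ring.
by apply: eq_Ex => w; rewrite VE.
Qed.

Lemma expectation_potYfrom s u : (s <= u)%N -> (u <= T.+1)%N ->
  ('E_P[potYfrom a s] =
   'E_P[fun w => (\prod_(s <= t < u) W t w * gamma P pi a u w)%R])%E.
Proof.
move=> su uT; rewrite -(subnK su) in uT *.
have [V [mV bV VE]] := weight_prod_hist uT.
have mVH : measurable_fun [set: Omega] (V \o hist D (u - s + s)).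
  exact: measurableT_comp mV (@mH _).
have [gi gE] := matches_gammaT1B (subnKC uT).
have Wg : (fun w => \prod_(s <= t < u - s + s) W t w
      * gamma P pi a (u - s + s) w)
    = (fun w => gamma P pi a (u - s + s) w * V (hist D (u - s + s) w)).
  by apply/funext => w; rewrite VE mulrC.
rewrite Wg !expectation_Ex; last 2 first.
- exact: integrable_aeboundedM.
- exact: integrable_potYfrom.
(* The whole product serves as test function at time [u], which allows [gamma] to be exchanged for
   [Y(a_u..)]. *)
congr (_%:E); rewrite -(Ex_weight_prod uT) gE//.
by apply: eq_Ex => w; rewrite VE.
Qed.

End Identification.

Theorem theorem4p1 (d : measure_display) (Omega : measurableType d)
    (R : realType) (P : probability Omega R) (T : nat)
    (D : longData Omega R T)
    (pi : forall t : nat, typZ D t * typH D t -> R)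
    (a : forall t : nat, typA D t) (s r : nat) :
  (forall abar : {dffun forall t : 'I_T.+1, typA D t},
     P.-integrable [set: Omega] (fun w => (potY D abar w)%:E)) ->
  consistency D P ->
  latent_ignorability D P ->
  IV_independence D P ->
  (forall t : nat, (t <= T)%N -> additive_IV D P t) ->
  (forall t : nat, (t <= T)%N -> regular_weight P (pi t)) ->
  (s <= T.+1)%N -> (s + r <= T.+1)%N ->
  ('E_P[potYfrom a s] =
   'E_P[fun w =>
     ((\prod_(s <= t < T.+1 - r)
         ((weightRV (pi t) w
             - cexp P (hist D t) (weightRV (pi t)) (hist D t w))
          * trtI (a t) w
          / ccov P (hist D t) (trtI (a t)) (weightRV (pi t)) (hist D t w)))
      * gamma P pi a (T.+1 - r) w)%R])%E.
Proof.
(* The inclusive upper index [T - r] is the exclusive bound [u = T.+1 - r]. *)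
move=> potYi consY ignY ivU addIV regW _ srT; apply: expectation_potYfrom => //.
  by rewrite -(addnK r s); exact: leq_sub2r.
exact: leq_subr.
Qed.
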